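(* Let $\Bbbk$ be a field, let $\mathcal{L}\subset\mathbb{Z}^n$ be a lattice with $\mathcal{L}\cap\mathbb{N}^n=\{\mathbf 0\}$, let $R=\Bbbk[x_1,\ldots,x_n]$ and let $I_{\mathcal{L}}\subset R$ be the lattice ideal of $\mathcal{L}$. Then the generalized algebraic Scarf complex $(\mathbf G_{\mathcal{L}},\theta)$ is an indispensable complex for $R/I_{\mathcal{L}}$.
   Context: Grading. Let $\mathbf a_i=e_i+\mathcal L\in\mathbb Z^n/\mathcal L$ and let $\mathcal A$ be the subsemigroup (containing $\mathbf 0$) of $\mathbb Z^n/\mathcal L$ generated by $\mathbf a_1,\dots,\mathbf a_n$. $R$ is $\mathcal A$-graded by $\deg_{\mathcal A}(\mathbf x^{\mathbf v})=\mathbf v+\mathcal L$. The lattice ideal $I_{\mathcal L}$ is generated by all $\mathbf x^{\mathbf u_+}-\mathbf x^{\mathbf u_-}$ with $\mathbf u_+,\mathbf u_-\in\mathbb N^n$, $\mathbf u_+-\mathbf u_-\in\mathcal L$; it is $\mathcal A$-homogeneous. For $\mathbf b\in\mathcal A$ the fiber is $C_{\mathbf b}=\{\mathbf x^{\mathbf u}:\deg_{\mathcal A}(\mathbf x^{\mathbf u})=\mathbf b\}$ (a finite set). Gcd-complex. $\Delta_{\gcd}(\mathbf b)$ is the simplicial complex on the vertex set $C_{\mathbf b}$ whose faces are the subsets $T\subset C_{\mathbf b}$ with $\gcd(T)\ne1$, where $\gcd(T)$ is the gcd of the monomials in $T$. The sets $C_J$. For nonempty finite $J\subset\mathcal L$,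 $\mathbf{max}(J)\in\mathbb Z^n$ is the componentwise maximum of the elements of $J$, and $C_J=\{\mathbf x^{\mathbf{max}(J)-\mathbf a}:\mathbf a\in J\}$, which is a subset of the fiber $C_{\mathbf{max}(J)+\mathcal L}$. Basic components. $G\subset C_{\mathbf b}$ is a basic component of $C_{\mathbf b}$ if: (1) $G=C_J$ for some (nonempty finite) $J\subset\mathcal L$; (2) $\gcd(G\setminus\{m\})\neq1$ for all $m\in G$ (with the convention that $\gcd(\emptyset)\ne 1$); (3) if $|C_{\mathbf b}|>2$, then $G$ is (the vertex set of) a connected component of $\Delta_{\gcd}(\mathbf b)$. A basic fiber component is a basic component of some fiber. For a nonempty subset $T$ of a fiber, $[T]=\{m/\gcd(T): m\in T\}$. If $C$ is a basic fiber component with $|C|\ge2$ and $m\in C$, then $[C\setminus\{m\}]$ is again a basic fiber component. Generalized algebraic Scarf complex. $\mathbf G_{\mathcal L}=\bigoplus_C R\cdot E_C$, the sum over all basic fiber components $C$, where $E_C$ is a basis vector in homological degree $|C|-1$ and of $\mathcal A$-degree $\mathbf b$ if $C\subset C_{\mathbf b}$. The differential is $$\theta(E_C)=\sum_{m\in C}\operatorname{sign}(m,C)\,\gcd(C\setminus\{m\})\,E_{[C\setminus\{m\}]}$$ for $|C|\geq 2$, where $\operatorname{sign}(m,C)=(-1)^{l+1}$ if $m$ is in the $l$-th position in the lexicographic ordering of $C$ (and $\theta(E_{\{1\}})=0$). Simple resolutions. Let $(\mathbf F,\phi)$ be an $\mathcal A$-graded free resolution $\cdots\to F_1\xrightarrow{\phi_1}F_0\xrightarrow{\phi_0}R/I_{\mathcal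 L}\to0$ with $\mathcal A$-homogeneous bases $B_j=\{E_{tj}\}_t$ of $F_j$. For an $\mathcal A$-homogeneous $h\in\ker\phi_j$, the syzygy support $S(h)$ is the set of all $\mathbf x^{\mathbf a}E_{tj}$ occurring with nonzero coefficient (in $\Bbbk$) when $h$ is expanded in the $\Bbbk$-basis $\{\mathbf x^{\mathbf a}E_{tj}\}$ of $F_j$. A nonzero $\mathcal A$-homogeneous $h\in\ker\phi_j$ is simple if there is no nonzero $\mathcal A$-homogeneous $h'\in\ker\phi_j$ with $S(h')\subsetneq S(h)$. $\mathbf F$ is simple with respect to the bases $B_j$ if $\phi_j(E_{tj})\in\ker\phi_{j-1}$ is simple (with respect to $B_{j-1}$) for all $j\ge1$ and all $t$. Indispensable complex. An $\mathcal A$-graded complex $(\mathbf G,\theta)$ is an indispensable complex for $R/I_{\mathcal L}$ if for every minimal $\mathcal A$-graded free resolution $(\mathbf F,\phi)$ of $R/I_{\mathcal L}$ that is simple with respect to $\mathcal A$-homogeneous bases $B_j$ of $F_j$, there is an injective ($\mathcal A$-graded) chain map $\iota:(\mathbf G,\theta)\to(\mathbf F,\phi)$ whose image is a subcomplex of $\mathbf F$ and such that for each $j$ there is a subset $B_j'\subset B_j$ for which $\iota^{-1}(B_j')$ is an $\mathcal A$-homogeneous basis of $G_j$. *)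

(* Defs.v *)
From HB Require Import structures.
From mathcomp Require Import all_boot all_order all_algebra.
From mathcomp Require Import finmap boolp.
From mathcomp Require Import mpoly freeg.

Set Implicit Arguments.
Unset Strict Implicit.
Unset Printing Implicit Defensive.

Import Order.TTheory GRing.Theory Num.Theory.

Local Open Scope quotient_scope.
Local Open Scope fset_scope.
Local Open Scope ring_scope.

(* [zmodClosed 'rV[int]_n] is the type of boolean subgroups of Z^n. As every  *)
(* subgroup of Z^n is finitely generated, it is decidable, so that these are  *)
(* all the lattices of Z^n.                                                   *)

Section Grading.
Variables (n : nat) (L : zmodClosed 'rV[int]_n).

Definition deg_group := {ideal_quot L}.
HB.instance Definition _ := GRing.Zmodule.on deg_group.
HB.instance Definition _ := Quotient.on deg_group.

Definition deg_gen (i : 'I_n) : deg_group := \pi_deg_group (delta_mx 0 i).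

Definition in_deg_semigroup (b : deg_group) : Prop :=
  exists c : 'I_n -> nat, b = \sum_i deg_gen i *+ c i.

Definition expv (u : 'X_{1..n}) : 'rV[int]_n := \row_i (u i)%:Z.

Definition degA (u : 'X_{1..n}) : deg_group := \pi_deg_group (expv u).

Definition fiber (b : deg_group) : pred 'X_{1..n} := [pred u | degA u == b].

Definition homog_poly (k : fieldType) (b : deg_group) (p : {mpoly k[n]}) :
  Prop := forall u, u \in msupp p -> degA u = b.

End Grading.

Section LatticeIdeal.
Variables (n : nat) (k : fieldType) (L : zmodClosed 'rV[int]_n).
Local Notation R := {mpoly k[n]}.

Definition lattice_binomial (p : R) : Prop :=
  exists u v : 'X_{1..n}, expv u - expv v \in L /\ p = 'X_[u] - 'X_[v].

Definition in_lattice_ideal (p : R) : Prop :=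
  exists s : seq (R * R),
    (forall f, f \in s -> lattice_binomial f.2) /\ p = \sum_(f <- s) f.1 * f.2.

Definition lattice_ideal : {pred R} := fun p => `[< in_lattice_ideal p >].

Lemma lattice_idealP p : reflect (in_lattice_ideal p) (p \in lattice_ideal).
Proof. exact: asboolP. Qed.

Lemma lattice_idealMl a p : p \in lattice_ideal -> a * p \in lattice_ideal.
Proof.
case/lattice_idealP=> s [sL ->]; apply/lattice_idealP.
exists [seq (a * f.1, f.2) | f <- s]; split=> [f /mapP[g gs ->] /=|].
  exact: sL.
by rewrite big_map mulr_sumr; apply: eq_bigr => f _ /=; rewrite mulrA.
Qed.

Fact lattice_ideal_zmod_closed : zmod_closed lattice_ideal.
Proof.
split=> [|p q].
  by apply/lattice_idealP; exists [::]; split=> //; rewrite big_nil.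
move=> /lattice_idealP[s [sL ->]] /(lattice_idealMl (-1)).
rewrite mulN1r => /lattice_idealP[t [tL ->]]; apply/lattice_idealP.
exists (s ++ t); rewrite big_cat; split=> // f.
by rewrite mem_cat => /orP[/sL|/tL].
Qed.

HB.instance Definition _ :=
  GRing.isZmodClosed.Build R lattice_ideal lattice_ideal_zmod_closed.

(* The quotient R / I_L is used as an R-module.                               *)
Definition lattice_quot := {ideal_quot lattice_ideal}.
HB.instance Definition _ := GRing.Zmodule.on lattice_quot.
HB.instance Definition _ := Quotient.on lattice_quot.

Definition quot_scale (a : R) (q : lattice_quot) : lattice_quot :=
  \pi_lattice_quot (a * repr q).

Lemma quot_eqE p q :
  (\pi_lattice_quot p == \pi_lattice_quot q) = (p - q \in lattice_ideal).
Proof. by rewrite [RHS]Quotient.idealrBE. Qed.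

Lemma quot_scale_pi a p :
  quot_scale a (\pi_lattice_quot p) = \pi_lattice_quot (a * p).
Proof.
apply/eqP; rewrite quot_eqE -mulrBr lattice_idealMl // -quot_eqE.
by rewrite reprK.
Qed.

Lemma quot_piD p q :
  \pi_lattice_quot (p + q) = \pi_lattice_quot p + \pi_lattice_quot q.
Proof. exact: Quotient.pi_add. Qed.

Fact quot_scaleA a b q : quot_scale a (quot_scale b q) = quot_scale (a * b) q.
Proof.
by elim/quotW: q => p; rewrite (quot_scale_pi b) !quot_scale_pi mulrA.
Qed.

Fact quot_scale1 : left_id 1 quot_scale.
Proof. by elim/quotW=> p; rewrite quot_scale_pi mul1r. Qed.

Fact quot_scaleDr : right_distributive quot_scale +%R.
Proof.
move=> a; elim/quotW=> p; elim/quotW=> q.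
by rewrite -quot_piD !quot_scale_pi mulrDr quot_piD.
Qed.

Fact quot_scaleDl q : {morph quot_scale^~ q : a b / a + b}.
Proof.
by elim/quotW: q => p a b; rewrite !quot_scale_pi mulrDl quot_piD.
Qed.

HB.instance Definition _ := GRing.Zmodule_isLmodule.Build R lattice_quot
  quot_scaleA quot_scale1 quot_scaleDr quot_scaleDl.

Definition quot_hom (b : deg_group L) (q : lattice_quot) : Prop :=
  exists2 p, homog_poly b p & q = \pi_lattice_quot p.

End LatticeIdeal.

Section GradedModules.
Variables (n : nat) (k : fieldType) (L : zmodClosed 'rV[int]_n).
Local Notation R := {mpoly k[n]}.

(* [hom b] is the homogeneous component of degree [b]. The grading is indexed *)
(* by the whole group Z^n / L, with nonzero components only in the semigroup. *)
Record is_grading (M : lmodType R) (hom : deg_group L -> M -> Prop) : Prop := {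
  grading0 : forall b, hom b 0;
  gradingB : forall b x y, hom b x -> hom b y -> hom b (x - y);
  gradingZ : forall a b p x, homog_poly a p -> hom b x -> hom (a + b) (p *: x);
  grading_supp : forall b x, hom b x -> x != 0 -> in_deg_semigroup b;
  grading_sum : forall x, exists (s : seq (deg_group L)) (f : deg_group L -> M),
    [/\ uniq s, forall b, hom b (f b) & x = \sum_(b <- s) f b];
  grading_direct : forall (s : seq (deg_group L)) (f : deg_group L -> M),
    uniq s -> (forall b, hom b (f b)) -> \sum_(b <- s) f b = 0 ->
    forall b, b \in s -> f b = 0 }.

Definition homogeneous (M : lmodType R) (hom : deg_group L -> M -> Prop)
  (x : M) : Prop := exists b, hom b x.

Definition expansion (M : lmodType R) (B : M -> Prop) (x : M)
    (s : seq M) (c : M -> R) : Prop :=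
  [/\ uniq s, forall e, e \in s -> B e & x = \sum_(e <- s) c e *: e].

Definition is_basis (M : lmodType R) (B : M -> Prop) : Prop :=
  (forall x, exists s c, expansion B x s c) /\
  (forall s c, expansion B 0 s c -> forall e, e \in s -> c e = 0).

(* The pair (u, e) stands for the element 'X_[u] *: e of the k-basis.         *)
Definition syz_support (M : lmodType R) (B : M -> Prop) (h : M)
    (u : 'X_{1..n}) (e : M) : Prop :=
  exists s c, [/\ expansion B h s c, e \in s & (c e)@_u != 0].

Definition syz_support_proper (M : lmodType R) (B : M -> Prop) (h' h : M) :
    Prop :=
  (forall u e, syz_support B h' u e -> syz_support B h u e) /\
  ~ (forall u e, syz_support B h u e -> syz_support B h' u e).

Definition simple_in (M : lmodType R) (hom : deg_group L -> M -> Prop)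
    (B : M -> Prop) (ker : M -> Prop) (h : M) : Prop :=
  [/\ h != 0, homogeneous hom h, ker h &
      ~ exists h', [/\ h' != 0, homogeneous hom h', ker h' &
                       syz_support_proper B h' h]].

(* Complexes are indexed by homological degrees >= 0; [theta j] goes from     *)
(* degree j + 1 to degree j, and the map out of degree 0 is zero.             *)
Definition graded_complex (G : nat -> lmodType R)
    (homG : forall j, deg_group L -> G j -> Prop)
    (theta : forall j, {linear G j.+1 -> G j}) : Prop :=
  [/\ forall j, is_grading (homG j),
      forall j b x, homG j.+1 b x -> homG j b (theta j x) &
      forall j x, theta j (theta j.+1 x) = 0].

Section Resolutions.
(* Index shift: [phi j] is \phi_{j+1} and [phi0] is the augmentation \phi_0.  *)
Variables (F : nat -> lmodType R) (hom : forall j, deg_group L -> F j -> Prop).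
Variables (phi : forall j, {linear F j.+1 -> F j}).
Variables (phi0 : {linear F 0 -> lattice_quot k L}).

Definition syzygy (j : nat) : F j -> Prop :=
  match j with
  | 0 => fun x => phi0 x = 0
  | j'.+1 => fun x => phi j' x = 0
  end.

Record graded_resolution : Prop := {
  res_grading : forall j, is_grading (@hom j);
  res_phi_hom : forall j b x, hom b x -> hom b (phi j x);
  res_phi0_hom : forall b x, hom b x -> quot_hom b (phi0 x);
  res_surj : forall q, exists x, phi0 x = q;
  res_exact : forall j (x : F j), syzygy x <-> exists y, phi j y = x }.

Definition homogeneous_basis (j : nat) (B : F j -> Prop) : Prop :=
  is_basis B /\ forall e, B e -> homogeneous (@hom j) e.

(* The image of each \phi_{j+1} lies in (x_1, ..., x_n) F_j.                  *)
Definition minimal_resolution : Prop :=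
  forall j x, exists y : 'I_n -> F j, phi j x = \sum_i 'X_i *: y i.

Definition simple_resolution (B : forall j, F j -> Prop) : Prop :=
  forall j e, B j.+1 e -> simple_in (@hom j) (B j) (@syzygy j) (phi j e).

End Resolutions.

(* The fourth clause on [iota] says that its image is a subcomplex.           *)
Definition indispensable_complex (G : nat -> lmodType R)
    (homG : forall j, deg_group L -> G j -> Prop)
    (theta : forall j, {linear G j.+1 -> G j}) : Prop :=
  graded_complex homG theta /\
  forall (F : nat -> lmodType R) (hom : forall j, deg_group L -> F j -> Prop)
    (phi : forall j, {linear F j.+1 -> F j})
    (phi0 : {linear F 0 -> lattice_quot k L}) (B : forall j, F j -> Prop),
    graded_resolution hom phi phi0 ->
    (forall j, homogeneous_basis hom (B j)) ->
    minimal_resolution phi ->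
    simple_resolution hom phi phi0 B ->
    exists iota : forall j, {linear G j -> F j},
      [/\ forall j, injective (iota j),
          forall j x, iota j (theta j x) = phi j (iota j.+1 x),
          forall j b x, homG j b x -> hom j b (iota j x),
          forall j x, exists y, phi j (iota j.+1 x) = iota j y &
          forall j, exists B' : F j -> Prop,
            (forall e, B' e -> B j e) /\
            homogeneous_basis homG (fun x : G j => B' (iota j x))].

End GradedModules.

Section Scarf.
Variables (n : nat) (L : zmodClosed 'rV[int]_n).
Local Notation mon := 'X_{1..n}.

(* The seed of both folds is an element of the set, so that it does not       *)
(* affect the minimum or maximum; the value on the empty set is junk.         *)
Definition gcd_set (T : {fset mon}) : mon :=
  [multinom \big[minn/head 0%MM T i]_(m <- T) m i | i < n].

Definition max_set (J : {fset 'rV[int]_n}) : 'rV[int]_n :=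
  \row_i \big[Num.max/head 0 J 0 i]_(a <- J) a 0 i.

Definition gcd_neq1 (T : {fset mon}) : bool :=
  (T == fset0) || (gcd_set T != 0%MM).

(* Left inverse of [expv], meant for vectors with nonnegative entries.        *)
Definition mon_of (v : 'rV[int]_n) : mon := [multinom absz (v ord0 i) | i < n].

Definition lattice_mons (J : {fset 'rV[int]_n}) : {fset mon} :=
  [fset mon_of (max_set J - a) | a in J].

Definition gcd_face (b : deg_group L) (T : {fset mon}) : bool :=
  all (fiber b) T && gcd_neq1 T.

Definition gcd_edge (b : deg_group L) : rel mon :=
  fun u v => gcd_face b [fset u; v].

Definition gcd_component (b : deg_group L) (G : {fset mon}) : Prop :=
  exists2 u, u \in fiber b &
    forall v, v \in G <-> v \in fiber b /\
      exists2 p : seq mon, path (gcd_edge b) u p & v = last u p.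

(* The fibre is not assumed finite here, so |C_b| > 2 is expressed by the     *)
(* existence of a finite subset with more than two elements.                  *)
Definition fiber_gt2 (b : deg_group L) : Prop :=
  exists2 T : {fset mon}, {subset T <= fiber b} & (2 < #|` T|)%N.

Record basic_component (b : deg_group L) (G : {fset mon}) : Prop := {
  basic_sub : {subset G <= fiber b};
  basic_lattice : exists J : {fset 'rV[int]_n},
    [/\ J != fset0, {subset J <= L} & G = lattice_mons J];
  basic_gcd : forall m, m \in G -> gcd_neq1 (G `\ m);
  basic_conn : fiber_gt2 b -> gcd_component b G }.

Definition basic_fiber_component (G : {fset mon}) : Prop :=
  exists b : deg_group L, basic_component b G.

Definition bracket (T : {fset mon}) : {fset mon} :=
  [fset (m - gcd_set T)%MM | m in T].

(* The order of the library on monomials is graded, hence the detour through  *)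
(* sequences, whose order is lexicographic. The resulting order is increasing *)
(* and compares the exponents of x_1 first.                                   *)
Definition lex_le : rel mon :=
  fun u v => ((val u : seqlexi nat) <= (val v : seqlexi nat))%O.

Definition position (m : mon) (C : {fset mon}) : nat :=
  (index m (sort lex_le C)).+1.

Definition basic_index (j : nat) : predArgType :=
  {C : {fset mon} | `[< basic_fiber_component C >] && (#|` C| == j.+1)}.

Variable k : fieldType.
Local Notation R := {mpoly k[n]}.

Definition scarf_module (j : nat) : lmodType R := {freeg (basic_index j) / R}.

Definition scarf_hom (j : nat) (b : deg_group L) (g : scarf_module j) : Prop :=
  forall (C : basic_index j) (u m : mon),
    u \in msupp (coeff C g) -> m \in val C -> degA L u + degA L m = b.

(* The default value 0 is not reached in the differential: [C \ m] is again   *)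
(* a basic fiber component when C is one with at least two elements.          *)
Definition scarf_elt (j : nat) (C : {fset mon}) : scarf_module j :=
  if insub C is Some c then << (c : basic_index j) >> else 0.

Definition scarf_diff_elt (j : nat) (C : basic_index j.+1) : scarf_module j :=
  \sum_(m <- val C)
    (-1) ^+ (position m (val C)).+1 *:
      ('X_[gcd_set (val C `\ m)] *: scarf_elt j (bracket (val C `\ m))).

Definition scarf_diff (j : nat) : scarf_module j.+1 -> scarf_module j :=
  fglift (@scarf_diff_elt j).

Fact scarf_diff_is_linear j : linear (@scarf_diff j).
Proof.
have subD : {morph @scarf_diff j : x y / x - y}.
  exact: (lift_is_additive (@scarf_diff_elt j)).
have D0 : scarf_diff (0 : scarf_module j.+1) = 0 by rewrite -(subrr 0) subD subrr.
have addD : {morph @scarf_diff j : x y / x + y}.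
  move=> x y; rewrite -[y in LHS]opprK subD -[- y]sub0r subD D0 sub0r.
  by rewrite opprK.
have scaleU a C (c : R) :
    a *: (<< c *g C >> : scarf_module j.+1) = << a * c *g C >>.
  by apply/eqP/freeg_eqP => C'; rewrite coeffZ !coeffU mulrA.
move=> a g h; rewrite addD; congr (_ + _).
have -> : g = \sum_(C <- dom g) << coeff C g *g C >> by rewrite freeg_sumE.
rewrite scaler_sumr !(big_morph _ addD D0) scaler_sumr.
by apply: eq_bigr => C _; rewrite scaleU /scarf_diff !liftU scalerA.
Qed.

HB.instance Definition _ j :=
  GRing.isLinear.Build R (scarf_module j.+1) (scarf_module j) *:%R
    (@scarf_diff j) (@scarf_diff_is_linear j).

Definition scarf_theta (j : nat) :
  {linear scarf_module j.+1 -> scarf_module j} := @scarf_diff j.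

End Scarf.

(* Main.v *)
Require Import Defs.
From HB Require Import structures.
From mathcomp Require Import all_boot all_order all_algebra.
From mathcomp Require Import finmap boolp.
From mathcomp Require Import mpoly freeg.

(* A basic fiber component D is a union of connected components of the        *)
(* gcd-complex all of whose proper subsets T are faces. Every such T is cut   *)
(* out of the fiber by divisibility by gcd(T), so [T] is the whole fiber of   *)
(* its degree. In a minimal resolution F a basis element y can only have a    *)
(* degree whose fiber has gcd 1. Therefore the monomial multiples             *)
(* x^u y (u <> 0) supported in D correspond to the proper subsets T of D, and *)
(* the part of F supported in D is the simplicial chain complex of the        *)
(* boundary of a simplex, twisted by nonzero scalars. By induction on the     *)
(* homological degree, exactness and minimality produce a basis element x     *)
(* with a term of phi(x) supported in D, simplicity forces all of phi(x) into *)
(* D, and phi(x) is then a multiple of the fundamental cycle, which is the    *)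
(* image of theta(E_D).                                                       *)

Set Implicit Arguments.
Unset Strict Implicit.
Unset Printing Implicit Defensive.

Import Order.TTheory GRing.Theory Num.Theory.
Local Open Scope quotient_scope.
Local Open Scope fset_scope.
Local Open Scope ring_scope.

(** * Monomials, gcds and degrees *)

(** The embedding sends E_C to [mu C] times [e C], where [e C] is a basis element of F_j with the
    degree of C and [mu C] is a nonzero scalar. Two facts make this choice possible. On the
    combinatorial side ([face_mem], [face_basic]), a nonempty subset T of a basic component D
    consists of the elements of D divisible by gcd(T), and [T] is again a basic fiber component. On
    the algebraic side ([no_common_divisor], [term_faceP]), a term x^u y of F with u nonzero that is
    supported in D determines a proper face of D with gcd x^u whose bracket is the fiber of the
    degree of y. The induction on the homological degree carries the record [scarf_part]. In
    [step_exists], exactness lifts the boundary of D to F, a count of elements shows that some basis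
    element x of the degree of D occurs in the lift, [simple_term_in] confines phi(x) to D, and
    [part_cycle] makes phi(x) a multiple of that boundary. By coning, [next_full] shows that no
    other basis elements live over basic components; [next_cycle] renews the vanishing statement.
    [part_zero] starts the induction and [part_chain] assembles it. *)

Section Mon.
Variable n : nat.
Local Notation mon := 'X_{1..n}.
Implicit Types (a b u v w m : mon) (S T : {fset mon}).

Lemma lepm_anti u v : (u <= v)%MM -> (v <= u)%MM -> u = v.
Proof.
move=> /mnm_lepP uv /mnm_lepP vu; apply/mnmP => i; apply/eqP.
by rewrite eqn_leq uv vu.
Qed.

Lemma lep0m u : (0 <= u)%MM.
Proof. by apply/mnm_lepP => i; rewrite mnm0E. Qed.

Lemma lepm0_eq0 u : (u <= 0)%MM -> u = 0%MM.
Proof. by move=> u0; apply: lepm_anti (lep0m u). Qed.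

Lemma subKm u v : (u <= v)%MM -> (u + (v - u))%MM = v.
Proof. by move=> uv; rewrite addmC submK. Qed.

Lemma addKm u v : ((u + v) - u)%MM = v.
Proof. by rewrite addmC addmK. Qed.

Lemma lepm_add2l u v w : (u + v <= u + w)%MM = (v <= w)%MM.
Proof.
by apply/mnm_lepP/mnm_lepP => h i; have := h i; rewrite !mnmDE leq_add2l.
Qed.

Lemma leq_bigmin_seq (I : eqType) (s : seq I) (F : I -> nat) x c :
  (x <= \big[minn/c]_(j <- s) F j)%N = (x <= c)%N && all (fun j => x <= F j)%N s.
Proof.
by elim: s => [|a s IH]; rewrite ?big_nil ?andbT // big_cons leq_min IH /= andbCA.
Qed.

Lemma le_gcd_set u T : T != fset0 ->
  (u <= gcd_set T)%MM <-> {in T, forall m, (u <= m)%MM}.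
Proof.
case/fset0Pn => m0 m0T.
have hT : head 0%MM T \in T.
  have: forall s : seq mon, m0 \in s -> head 0%MM s \in s.
    by case=> //= x s _; rewrite mem_head.
  exact.
split=> [/mnm_lepP h m mT | h]; apply/mnm_lepP => i.
  by have := h i; rewrite mnmE leq_bigmin_seq => /andP[_ /allP]; apply.
rewrite mnmE leq_bigmin_seq; apply/andP; split; first exact/mnm_lepP/h.
by apply/allP => m mT; apply/mnm_lepP/h.
Qed.

Lemma gcd_set_le T m : m \in T -> (gcd_set T <= m)%MM.
Proof.
move=> mT; have T0 : T != fset0 by apply/fset0Pn; exists m.
by move/(le_gcd_set _ T0): (lepm_refl (gcd_set T)); apply.
Qed.

Lemma gcd_setS S T : S != fset0 -> S `<=` T -> (gcd_set T <= gcd_set S)%MM.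
Proof.
by move=> S0 /fsubsetP ST; apply/(le_gcd_set _ S0) => m /ST /gcd_set_le.
Qed.

Lemma gcd_set_absorb T m : T != fset0 -> (gcd_set T <= m)%MM ->
  gcd_set (m |` T) = gcd_set T.
Proof.
move=> T0 le_m; have mT0 : m |` T != fset0 by apply/fset0Pn; exists m; rewrite !inE eqxx.
apply: lepm_anti; first by apply: gcd_setS => //; exact: fsubsetUr.
apply/(le_gcd_set _ mT0) => x; rewrite !inE => /orP[/eqP-> //|]; exact: gcd_set_le.
Qed.

Lemma mem_bracket T w : T != fset0 ->
  (w \in bracket T) = ((gcd_set T + w)%MM \in T).
Proof.
move=> T0; apply/imfsetP/idP => /= [[m mT ->]|wT].
  by rewrite subKm ?gcd_set_le.
by exists (gcd_set T + w)%MM; rewrite ?addKm.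
Qed.

Lemma card_bracket T : #|` bracket T| = #|` T|.
Proof.
apply: card_in_imfset => u v uT vT /= /(congr1 (fun w => gcd_set T + w)%MM).
by rewrite !subKm ?gcd_set_le.
Qed.

Lemma bracket_neq0 T : (bracket T != fset0) = (T != fset0).
Proof. by rewrite -!cardfs_gt0 card_bracket. Qed.

(** Division by a common divisor [a] that need not be the gcd: removing a point from [bracket T]
    gives such a set, whose own gcd may be nontrivial. *)
Definition translate a T : {fset mon} := [fset (m - a)%MM | m in T].

Lemma mem_translate a T w : {in T, forall m, (a <= m)%MM} ->
  (w \in translate a T) = ((a + w)%MM \in T).
Proof.
move=> aT; apply/imfsetP/idP => /= [[m mT ->]|wT]; first by rewrite subKm ?aT.
by exists (a + w)%MM; rewrite ?addKm.
Qed.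

Lemma gcd_set_translate a T : T != fset0 -> {in T, forall m, (a <= m)%MM} ->
  (a + gcd_set (translate a T))%MM = gcd_set T.
Proof.
move=> T0 aT; have tT0 : translate a T != fset0.
  case/fset0Pn: T0 => m mT; apply/fset0Pn; exists (m - a)%MM.
  by rewrite mem_translate ?subKm ?aT.
have ag : (a <= gcd_set T)%MM by apply/le_gcd_set.
apply: lepm_anti.
  apply/(le_gcd_set _ T0) => m mT; rewrite -(subKm (aT _ mT)) lepm_add2l gcd_set_le //.
  by rewrite mem_translate ?subKm ?aT.
rewrite -(subKm ag) lepm_add2l; apply/(le_gcd_set _ tT0) => w.
by rewrite mem_translate // => /gcd_set_le; rewrite -{1}(subKm ag) lepm_add2l.
Qed.

(** With [bracketD1], this shows that the facets of [T] and those of T have the same brackets. *)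
Lemma bracket_translate a T : T != fset0 -> {in T, forall m, (a <= m)%MM} ->
  bracket (translate a T) = bracket T.
Proof.
move=> T0 aT; have tT0 : translate a T != fset0.
  case/fset0Pn: T0 => m mT; apply/fset0Pn; exists (m - a)%MM.
  by rewrite mem_translate ?subKm ?aT.
apply/fsetP => w; rewrite !mem_bracket // mem_translate //.
by rewrite addmA gcd_set_translate.
Qed.

Lemma bracketD1 T m : m \in T ->
  bracket T `\ (m - gcd_set T)%MM = translate (gcd_set T) (T `\ m).
Proof.
move=> mT; have T0 : T != fset0 by apply/fset0Pn; exists m.
apply/fsetP => w; rewrite mem_translate; last by move=> x /fsetD1P[_ /gcd_set_le].
rewrite !inE mem_bracket //; case: (_ \in T); rewrite ?andbF ?andbT //; congr (~~ _).
by apply/eqP/eqP => [->|<-]; rewrite ?subKm ?addKm ?gcd_set_le.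
Qed.

Lemma bracket_gcd0 T : T != fset0 -> gcd_set T = 0%MM -> bracket T = T.
Proof. by move=> T0 g0; apply/fsetP => w; rewrite mem_bracket // g0 add0m. Qed.

Lemma gcd_bracket T : T != fset0 -> gcd_set (bracket T) = 0%MM.
Proof.
move=> T0; apply: (@addmI _ (gcd_set T)); rewrite addm0.
exact: (@gcd_set_translate (gcd_set T) T T0 (@gcd_set_le T)).
Qed.

End Mon.

Section Degree.
Variables (n : nat) (L : zmodClosed 'rV[int]_n).
Local Notation mon := 'X_{1..n}.
Implicit Types (u v w m : mon).

Lemma expvD u v : expv (u + v)%MM = expv u + expv v.
Proof. by apply/rowP => i; rewrite !mxE mnmDE PoszD. Qed.

Lemma degAD u v : degA L (u + v)%MM = degA L u + degA L v.
Proof. by rewrite /degA expvD; exact: Quotient.pi_add. Qed.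

Lemma degA0 : degA L 0%MM = 0.
Proof. by apply: (addrI (degA L 0%MM)); rewrite -degAD add0m addr0. Qed.

Lemma degA_eq u v : (degA L u == degA L v) = (expv u - expv v \in L).
Proof. by rewrite [RHS]Quotient.idealrBE. Qed.

Lemma in_fiber u b : (u \in fiber b) = (degA L u == b). Proof. by []. Qed.

Lemma in_deg_semigroupP b : in_deg_semigroup b <-> exists u, u \in fiber (b : deg_group L).
Proof.
have degE u : degA L u = \sum_i deg_gen L i *+ u i.
  rewrite {1}(multinomUE_id u) (big_morph _ degAD degA0); apply: eq_bigr => i _.
  elim: (u i) => [|k IHk]; first by rewrite mulm0n degA0.
  rewrite mulmS degAD IHk mulrS; congr (_ + _).
  have eU : expv U_(i)%MM = delta_mx 0 i.
    by apply/rowP => l; rewrite !mxE mnm1E eqxx eq_sym; case: eqP.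
  by rewrite /degA eU.
split=> [[c ->]|[u /eqP <-]]; last by exists u.
exists [multinom c i | i < n]; rewrite in_fiber degE; apply/eqP.
by apply: eq_bigr => i _; rewrite mnmE.
Qed.

End Degree.

(** * Basic fiber components *)

Lemma gcd0_ex n (T : {fset 'X_{1..n}}) i : T != fset0 -> gcd_set T = 0%MM ->
  exists2 m : 'X_{1..n}, m \in T & m i = 0%N.
Proof.
move=> T0 g0; have [[m mT mi]|h] := pselect (exists2 m : 'X_{1..n}, m \in T & m i = 0%N).
  by exists m.
have : (U_(i) <= gcd_set T)%MM.
  apply/(le_gcd_set _ T0) => m mT; rewrite lep1mP; apply/eqP => mi; apply: h.
  by exists m.
by rewrite g0 lep1mP mnm0E.
Qed.

Lemma bigmax_mem (I : eqType) (s : seq I) (F : I -> int) c :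
  \big[Num.max/c]_(j <- s) F j \in c :: [seq F j | j <- s].
Proof.
elim: s => [|a s IH]; rewrite ?big_nil ?mem_head // big_cons /=.
by case: leP => _; move: IH; rewrite !inE ?eqxx ?orbT // => /orP[->|->]; rewrite ?orbT.
Qed.

Lemma le_bigmax_mem (I : eqType) (s : seq I) (F : I -> int) c j : j \in s ->
  F j <= \big[Num.max/c]_(j <- s) F j.
Proof.
elim: s => // a s IH; rewrite inE big_cons le_max => /orP[/eqP->|/IH->].
  by rewrite lexx.
by rewrite orbT.
Qed.

Lemma max_setP n (J : {fset 'rV[int]_n}) i : J != fset0 ->
  (exists2 a, a \in J & max_set J 0 i = a 0 i) /\
  {in J, forall a : 'rV[int]_n, a 0 i <= max_set J 0 i}.
Proof.
case/fset0Pn => a0 a0J; rewrite /max_set mxE; split=> [|a aJ]; last exact: le_bigmax_mem.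
have hJ : head 0 J \in J.
  have: forall s : seq 'rV[int]_n, a0 \in s -> head 0 s \in s.
    by case=> //= x s _; rewrite mem_head.
  exact.
have := bigmax_mem J (fun a : 'rV[int]_n => a 0 i) (head 0 J 0 i).
rewrite inE => /orP[/eqP->|/mapP[a aJ ->]]; first by exists (head 0 J).
by exists a.
Qed.

(** In each coordinate the maximum is attained by some [a] in J, and the monomial of that [a] has
    exponent 0 there. *)
Lemma gcd_lattice_mons n (J : {fset 'rV[int]_n}) : J != fset0 ->
  gcd_set (lattice_mons J) = 0%MM.
Proof.
move=> J0; apply/mnmP => i; have [[a aJ ai] _] := max_setP i J0.
have : mon_of (max_set J - a) \in lattice_mons J by apply/imfsetP; exists a.
move/gcd_set_le/mnm_lepP/(_ i); rewrite [mon_of _ i]mnmE [0%MM i]mnm0E.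
rewrite [X in absz X]mxE [X in absz (_ + X)]mxE ai subrr leqn0.
by move/eqP.
Qed.

Section Sphere.
Variables (n : nat) (L : zmodClosed 'rV[int]_n).
Local Notation mon := 'X_{1..n}.
Local Notation degA := (degA L).
Implicit Types (a u v w m : mon) (T D : {fset mon}) (b c : deg_group L).

(** The witness is J = {m0 - m : m in T} for a fixed m0 in T. As gcd(T) = 1, each variable is absent
    from some m, so the maximum of J is m0 and C_J gives T back. *)
Lemma lattice_mons_ex b T : T != fset0 -> {subset T <= fiber b} ->
  gcd_set T = 0%MM ->
  exists J : {fset 'rV[int]_n}, [/\ J != fset0, {subset J <= L} & T = lattice_mons J].
Proof.
move=> T0 Tb g0; have /fset0Pn[m0 m0T] := T0.
pose J := [fset expv m0 - expv m | m in T].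
have memJ m : m \in T -> expv m0 - expv m \in J by move=> mT; apply/imfsetP; exists m.
have J0 : J != fset0 by apply/fset0Pn; exists (expv m0 - expv m0); exact: memJ.
have maxJ : max_set J = expv m0.
  apply/rowP => i; have [[a /imfsetP[m /= mT ->] e] ub] := max_setP i J0.
  have [m1 m1T m1i] := gcd0_ex i T0 g0.
  apply/eqP; rewrite eq_le; apply/andP; split; last first.
    by apply: le_trans (ub _ (memJ _ m1T)); rewrite !mxE m1i subr0.
  by rewrite e !mxE lerBlDr lerDl.
exists J; split=> // [a /imfsetP[m /= mT ->]|].
  by rewrite -degA_eq (eqP (Tb _ mT)) (eqP (Tb _ m0T)).
apply/fsetP => m; rewrite /lattice_mons maxJ; apply/idP/imfsetP => /= [mT|[a]].
  exists (expv m0 - expv m); first exact: memJ.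
  by apply/mnmP => i; rewrite mnmE !mxE subKr.
move=> /imfsetP[m' /= m'T ->] ->; rewrite (_ : mon_of _ = m') //.
by apply/mnmP => i; rewrite mnmE !mxE subKr.
Qed.

(* A union of connected components of the gcd-complex whose only non-face is  *)
(* the whole set.                                                             *)
Record gcd_sphere b D : Prop := {
  sphere_neq0 : D != fset0;
  sphere_deg : forall m, m \in D -> degA m = b;
  sphere_closed : forall a u v, a != 0%MM -> (a <= u)%MM -> (a <= v)%MM ->
    u \in D -> degA v = b -> v \in D;
  sphere_gcd : gcd_set D = 0%MM;
  sphere_facet : forall m, m \in D -> D `\ m != fset0 -> gcd_set (D `\ m) != 0%MM }.

Lemma gcd_pair a u v : a != 0%MM -> (a <= u)%MM -> (a <= v)%MM ->
  gcd_set [fset u; v] != 0%MM.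
Proof.
move=> a0 au av; apply: contra_neq a0 => g0; apply: lepm0_eq0; rewrite -g0.
apply/le_gcd_set; first by apply/fset0Pn; exists u; rewrite !inE eqxx.
by move=> m; rewrite !inE => /orP[/eqP->|/eqP->].
Qed.

(** Closedness has two cases. In a fiber with more than two elements D is a component, and u and v
    are adjacent. Otherwise an element v outside D leaves room for a single element in D; gcd 1
    makes that element 1, which has no divisor [a] other than 1. *)
Lemma basic_sphere b D : basic_component b D -> gcd_sphere b D.
Proof.
case=> Db [J [J0 JL eqD]] face conn.
have D0 : D != fset0.
  rewrite eqD; have /fset0Pn[a aJ] := J0.
  by apply/fset0Pn; exists (mon_of (max_set J - a)); apply/imfsetP; exists a.
have gD : gcd_set D = 0%MM by rewrite eqD gcd_lattice_mons.
split=> // [m /Db/eqP // | a u v a0 au av uD bv | m mD]; last first.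
  by move=> Dm0; have := face _ mD; rewrite /gcd_neq1 (negPf Dm0).
have [big|small] := pselect (fiber_gt2 b).
  have [u0 u0b memD] := conn big.
  have /memD[ub [p pth lst]] := uD; apply/memD; split; first by rewrite in_fiber bv.
  exists (rcons p v); last by rewrite last_rcons.
  rewrite rcons_path pth /= -lst /gcd_edge /gcd_face /gcd_neq1 (gcd_pair a0 au av) orbT andbT.
  by apply/allP => w; rewrite !inE => /orP[/eqP->|/eqP->]; [exact: Db | apply/eqP].
have [//|vD] := boolP (v \in D).
case: (leqP #|` D| 1) => [D1|D2]; last first.
  case: small; exists (v |` D); last by rewrite cardfsU1 vD.
  by move=> w; rewrite !inE => /orP[/eqP->|/Db //]; rewrite bv.
have /cardfs1P[m Dm] : #|` D| == 1%N by rewrite eqn_leq D1 cardfs_gt0.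
have u_m : u = m by move: uD; rewrite Dm inE => /eqP.
case/eqP: a0; apply: lepm0_eq0; apply: lepm_trans au _.
rewrite -gD; apply/le_gcd_set => // w; rewrite Dm inE => /eqP->.
by rewrite u_m lepm_refl.
Qed.

(** The two elements of D are coprime, so no edge joins them and D cannot be a component of a larger
    fiber. This replaces [syz_part] in homological degree 0. *)
Lemma basic_card2 b D v : basic_component b D -> #|` D| = 2 -> degA v = b -> v \in D.
Proof.
move=> basD D2 bv; have sD := basic_sphere basD.
case: (boolP (v \in D)) => // vD.
have big : fiber_gt2 b.
  exists (v |` D); last by rewrite cardfsU1 vD D2.
  by move=> w; rewrite !inE => /orP[/eqP->|/(sphere_deg sD)->]; rewrite ?bv.
have [u0 u0b memD] := basic_conn basD big.
have u0D : u0 \in D by apply/memD; split=> //; exists [::].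
have /cardfs1P[w Dw] : #|` D `\ u0| == 1%N.
  by have := cardfsD1 u0 D; rewrite D2 u0D add1n => -[<-].
have eqD : D = [fset u0; w] by rewrite -(fsetD1K u0D) Dw.
have stay p : path (gcd_edge b) u0 p -> last u0 p = u0.
  elim: p => //= x p IH /andP[e pth].
  have : x \in D.
    apply/memD; split; last by exists [:: x] => //=; rewrite e.
    by case/andP: e => /allP/(_ x); rewrite !inE eqxx orbT => h _; exact: h.
  rewrite eqD !inE => /orP[/eqP xu|/eqP xw]; first by subst x; exact: IH.
  case/andP: e => _; rewrite xw -eqD /gcd_neq1 (negPf (sphere_neq0 sD)).
  by rewrite (sphere_gcd sD) eqxx.
have : w \in D by rewrite eqD !inE eqxx orbT.
case/memD => _ [p /stay -> wu].
have : w \in D `\ u0 by rewrite Dw inE.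
by rewrite wu !inE eqxx.
Qed.

(** If the fiber has more than two elements, any two of them avoid a third one x, and gcd(D \ x) is
    a nontrivial common divisor of the two. So any two elements are adjacent and D is connected. *)
Lemma full_basic c D : D != fset0 -> (forall v, (v \in D) = (degA v == c)) ->
  gcd_set D = 0%MM ->
  (forall m, m \in D -> D `\ m != fset0 -> gcd_set (D `\ m) != 0%MM) ->
  basic_component c D.
Proof.
move=> D0 memD gD face; have Dc : {subset D <= fiber c} by move=> m; rewrite memD.
split=> [||m mD|[T Tc T2]]; [exact: Dc|exact: (lattice_mons_ex D0 Dc gD)| |].
  by rewrite /gcd_neq1; case: eqVneq => //= Dm0; apply: face.
have /fset0Pn[u uD] := D0; exists u; first exact: Dc.
move=> v; split=> [vD|[vc _]]; last by rewrite memD.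
split; first exact: Dc.
exists [:: v] => //=; rewrite andbT /gcd_edge /gcd_face.
apply/andP; split.
  by apply/allP => w; rewrite !inE => /orP[/eqP->|/eqP->]; exact: Dc.
have [x xT xuv] : exists2 x, x \in T & x \notin [fset u; v].
  apply: contrapT => h; have/fsubset_leq_card : T `<=` [fset u; v].
    by apply/fsubsetP => x xT; apply: contrapT => /negP xuv; apply: h; exists x.
  by rewrite cardfs2 leqNgt => /negP; apply; apply: leq_trans T2; case: eqP.
have sub : [fset u; v] `<=` D `\ x.
  apply/fsubsetP => w wuv; rewrite !inE.
  apply/andP; split; first by apply: contraNneq xuv => <-.
  by move: wuv; rewrite !inE => /orP[/eqP->|/eqP->].
have uv0 : [fset u; v] != fset0 by apply/fset0Pn; exists u; rewrite !inE eqxx.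
have Dx0 : D `\ x != fset0.
  by apply: contra_neq uv0 => Dx; apply/eqP; rewrite -fsubset0 -Dx.
have xD : x \in D by rewrite memD; exact: Tc.
apply/orP; right; apply: contra_neq (face _ xD Dx0) => g0.
by apply: lepm0_eq0; rewrite -g0 gcd_setS.
Qed.

Section Faces.
Variables (b : deg_group L) (D : {fset mon}).
Hypothesis basD : basic_component b D.
Let sD : gcd_sphere b D := basic_sphere basD.

(** If m were outside T, gcd(D \ m) would divide gcd(T), hence m, and so would equal gcd(D) = 1. *)
Lemma face_mem T m : T != fset0 -> T `<=` D -> m \in D ->
  (gcd_set T <= m)%MM -> m \in T.
Proof.
move=> T0 TD mD le_m; case: (boolP (m \in T)) => // mT.
have sub : T `<=` D `\ m.
  apply/fsubsetP => x xT; rewrite !inE (fsubsetP TD) // andbT.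
  by apply: contraNneq mT => <-.
have Dm0 : D `\ m != fset0.
  by apply: contra_neq T0 => Dm; apply/eqP; rewrite -fsubset0 -Dm.
case/negP: (sphere_facet sD mD Dm0); rewrite -(sphere_gcd sD) -{2}(fsetD1K mD).
by rewrite gcd_set_absorb // (lepm_trans (gcd_setS T0 sub)).
Qed.

Lemma face_gcd_eq0 T : T != fset0 -> T `<=` D -> gcd_set T = 0%MM -> T = D.
Proof.
move=> T0 TD g0; apply/eqP; rewrite eqEfsubset TD; apply/fsubsetP => m mD.
by apply: face_mem => //; rewrite g0 lep0m.
Qed.

(** For v of the degree of w, the product gcd(T) v shares the factor gcd(T), which is not 1, with an
    element of D. Closedness puts it in D, and [face_mem] puts it in T. *)
Lemma face_fiber T w v : T != fset0 -> T `<=` D -> T != D ->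
  w \in bracket T -> (v \in bracket T) = (degA v == degA w).
Proof.
move=> T0 TD TnD; rewrite !mem_bracket // => wT.
have gT0 : gcd_set T != 0%MM by apply: contra_neq TnD; exact: face_gcd_eq0.
have bw := sphere_deg sD (fsubsetP TD _ wT).
apply/idP/eqP => [vT|vw].
  have := sphere_deg sD (fsubsetP TD _ vT); rewrite -bw !degAD; exact: addrI.
apply: face_mem => //; last exact: lem_addr.
apply: (sphere_closed sD gT0 (lem_addr _ w) (lem_addr _ v) (fsubsetP TD _ wT)).
by rewrite degAD vw -degAD.
Qed.

(** For T proper, [T] is a whole fiber and [full_basic] applies. Were the gcd of a facet of [T]
    equal to 1, then gcd(T \ m) = gcd(T) would divide m, and [face_mem] would put m in T \ m. *)
Lemma face_basic T : T != fset0 -> T `<=` D -> basic_fiber_component L (bracket T).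
Proof.
move=> T0 TD; case: (eqVneq T D) => [->|TnD].
  rewrite bracket_gcd0 ?(sphere_neq0 sD) ?(sphere_gcd sD) //; by exists b.
have bT0 : bracket T != fset0 by rewrite bracket_neq0.
have /fset0Pn[w wT] := bT0; exists (degA w); apply: full_basic => //.
- by move=> v; exact: face_fiber.
- exact: gcd_bracket.
move=> x xT; have mT : (gcd_set T + x)%MM \in T by rewrite -mem_bracket.
have -> : x = (gcd_set T + x - gcd_set T)%MM by rewrite addKm.
set m := (gcd_set T + x)%MM in mT *; rewrite bracketD1 // => tr0.
have Tm0 : T `\ m != fset0.
  by have/fset0Pn[y /imfsetP[z /= zT _]] := tr0; apply/fset0Pn; exists z.
apply/eqP => g0; have := @gcd_set_translate _ (gcd_set T) (T `\ m) Tm0.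
rewrite g0 addm0 => h; have : m \in T `\ m.
  apply: face_mem => //; last by rewrite -h ?gcd_set_le // => y /fsetD1P[_ /gcd_set_le].
    by apply: fsubset_trans TD; exact: fsubD1set.
  exact: (fsubsetP TD).
by rewrite !inE eqxx.
Qed.

End Faces.
End Sphere.

(** * Coordinates with respect to a basis *)

Lemma mcoeffXM n (k : fieldType) (p : {mpoly k[n]}) a u :
  ('X_[a] * p)@_u = if (a <= u)%MM then p@_(u - a) else 0.
Proof.
rewrite mulrC; case: ifP => [au|/negP nau]; first by rewrite -{1}(subKm au) mcoeffMX.
apply/eqP; apply: contrapT => /negP; rewrite -mcoeff_msupp => h; apply: nau.
by move: h; rewrite (perm_mem (msuppMX _ _)) => /mapP[w _ ->]; exact: lem_addr.
Qed.

Section Coord.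
Variables (n : nat) (k : fieldType).
Local Notation R := {mpoly k[n]}.
Local Notation mon := 'X_{1..n}.
Variables (M : lmodType R) (B : M -> Prop).

(** A basis is a predicate, so an expansion has to be chosen; the default is not reached when [B] is
    a basis. *)
Definition coord_exp (x : M) : seq M * (M -> R) :=
  if pselect (exists sc : seq M * (M -> R), expansion B x sc.1 sc.2) is left h
  then sval (cid h) else ([::], fun=> 0).

Definition bcoord (x e : M) : R :=
  if e \in (coord_exp x).1 then (coord_exp x).2 e else 0.

Definition cf (x : M) (u : mon) (e : M) : k := (bcoord x e)@_u.

Definition term_seq (x : M) : seq (mon * M) :=
  [seq (u, e) | e <- (coord_exp x).1, u <- msupp (bcoord x e)].

Definition proj (P : mon -> M -> Prop) (x : M) : M :=
  \sum_(t <- term_seq x | `[< P t.1 t.2 >])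
    (cf x t.1 t.2)%:MP *: ('X_[t.1] *: t.2).

Hypothesis hB : is_basis B.

Lemma coord_expP x : expansion B x (coord_exp x).1 (coord_exp x).2.
Proof.
rewrite /coord_exp; case: pselect => [h|]; first by case: (cid h).
by have [s [c h]] := hB.1 x; case; exists (s, c).
Qed.

Lemma sum_subseq (s t : seq M) (c : M -> R) : uniq s -> uniq t ->
  {subset s <= t} ->
  \sum_(e <- t) (if e \in s then c e else 0) *: e = \sum_(e <- s) c e *: e.
Proof.
move=> us ut st; rewrite (bigID (mem s)) /= [X in _ + X]big1 ?addr0; last first.
  by move=> e /negPf->; rewrite scale0r.
rewrite -big_filter (perm_big s); last first.
  apply: uniq_perm; rewrite ?filter_uniq // => e.
  by rewrite mem_filter /=; case: (boolP (e \in s)) => //= /st.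
by apply: eq_big_seq => e ->.
Qed.

(** Padded by zeros to a common list of basis elements, the two expansions of x differ by an
    expansion of 0. *)
Lemma coordE x s c e : expansion B x s c -> bcoord x e = if e \in s then c e else 0.
Proof.
case=> us sB ->; set x' := \sum_(_ <- _) _.
have [us' s'B x'E] := coord_expP x'; pose s' := (coord_exp x').1.
pose c' := (coord_exp x').2; pose t := undup (s' ++ s).
pose d e := bcoord x' e - (if e \in s then c e else 0).
have ut : uniq t by exact: undup_uniq.
have exp0 : expansion B 0 t d.
  split=> // [e'|]; first by rewrite mem_undup mem_cat => /orP[/s'B|/sB].
  under eq_bigr do rewrite scalerBl.
  rewrite sumrB /bcoord !sum_subseq //; first by rewrite -x'E subrr.
    by move=> e' h; rewrite mem_undup mem_cat h orbT.
  by move=> e' h; rewrite mem_undup mem_cat h.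
case: (boolP (e \in t)) => [et|]; first exact/subr0_eq/(hB.2 _ _ exp0).
by rewrite mem_undup mem_cat negb_or /bcoord => /andP[/negPf-> /negPf->].
Qed.

Lemma coord_sum x : x = \sum_(e <- (coord_exp x).1) bcoord x e *: e.
Proof.
have [_ _ xE] := coord_expP x; rewrite [LHS]xE.
by apply: eq_big_seq => e; rewrite /bcoord => ->.
Qed.

Lemma coord_basis x e : bcoord x e != 0 -> B e.
Proof.
have [_ xB _] := coord_expP x; rewrite /bcoord; case: ifP => [/xB //|_].
by rewrite eqxx.
Qed.

Lemma coordL a x y e : bcoord (a *: x + y) e = a * bcoord x e + bcoord y e.
Proof.
have [ux xB _] := coord_expP x; have [uy yB _] := coord_expP y.
pose t := undup ((coord_exp x).1 ++ (coord_exp y).1).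
have out z e' : e' \notin (coord_exp z).1 -> bcoord z e' = 0.
  by rewrite /bcoord => /negPf->.
have sub z : {subset (coord_exp z).1 <= t} -> z = \sum_(e <- t) bcoord z e *: e.
  move=> zt; rewrite sum_subseq ?undup_uniq //; first by have [_ _ {1}->] := coord_expP z.
  by have [] := coord_expP z.
rewrite (@coordE _ t (fun e => a * bcoord x e + bcoord y e)); last first.
  split=> [|e'|]; first exact: undup_uniq.
    by rewrite mem_undup mem_cat => /orP[/xB|/yB].
  have xt : {subset (coord_exp x).1 <= t} by move=> e' h; rewrite mem_undup mem_cat h.
  have yt : {subset (coord_exp y).1 <= t}.
    by move=> e' h; rewrite mem_undup mem_cat h orbT.
  rewrite {1}(sub x xt) {1}(sub y yt) scaler_sumr -big_split; apply: eq_bigr => e' _ /=.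
  by rewrite scalerA -scalerDl.
case: ifPn => //; rewrite mem_undup mem_cat negb_or => /andP[ex ey].
by rewrite !out // mulr0 addr0.
Qed.

Lemma bcoord0 e : bcoord 0 e = 0.
Proof.
have := coordL 1 0 0 e; rewrite scale1r addr0 mul1r => /esym/eqP.
by rewrite addrC -subr_eq0 addrK => /eqP.
Qed.

Lemma bcoordZ p x e : bcoord (p *: x) e = p * bcoord x e.
Proof. by rewrite -[p *: x]addr0 coordL bcoord0 addr0. Qed.

Lemma bcoord_sum I (r : seq I) (F : I -> M) e :
  bcoord (\sum_(i <- r) F i) e = \sum_(i <- r) bcoord (F i) e.
Proof.
apply: (big_morph (bcoord^~ e)) => [x y|]; last exact: bcoord0.
by rewrite -[x]scale1r coordL mul1r scale1r.
Qed.

Lemma cfL p x y u e : cf (p *: x + y) u e = (p * bcoord x e)@_u + cf y u e.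
Proof. by rewrite /cf coordL mcoeffD. Qed.

Lemma cfD x y u e : cf (x + y) u e = cf x u e + cf y u e.
Proof. by rewrite -[x]scale1r cfL mul1r scale1r. Qed.

Lemma cf0 u e : cf 0 u e = 0.
Proof. by apply: (addrI (cf 0 u e)); rewrite -cfD !addr0. Qed.

Lemma cfN x u e : cf (- x) u e = - cf x u e.
Proof. by apply: (addrI (cf x u e)); rewrite -cfD !subrr cf0. Qed.

Lemma cfB x y u e : cf (x - y) u e = cf x u e - cf y u e.
Proof. by rewrite cfD cfN. Qed.

Lemma cf_sum I (r : seq I) (P : pred I) (F : I -> M) u e :
  cf (\sum_(i <- r | P i) F i) u e = \sum_(i <- r | P i) cf (F i) u e.
Proof. by apply: (big_morph (fun x => cf x u e)) => [x y|]; rewrite ?cfD ?cf0. Qed.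

Lemma cfZ p x u e : cf (p *: x) u e = (p * bcoord x e)@_u.
Proof. by rewrite -[p *: x]addr0 cfL cf0 addr0. Qed.

Lemma cfC c x u e : cf (c%:MP *: x) u e = c * cf x u e.
Proof. by rewrite cfZ mcoeffCM. Qed.

Lemma cfX a x u e :
  cf ('X_[a] *: x) u e = if (a <= u)%MM then cf x (u - a)%MM e else 0.
Proof. by rewrite cfZ mcoeffXM. Qed.

Lemma coord_of_basis e e' : B e -> bcoord e e' = (e == e')%:R.
Proof.
move=> Be; rewrite (@coordE _ [:: e] (fun=> 1)) ?inE; last first.
  split=> // [x|]; first by rewrite inE => /eqP->.
  by rewrite big_seq1 scale1r.
by rewrite eq_sym; case: eqP.
Qed.

Lemma cf_of_basis e u e' : B e -> cf e u e' = ((0%MM, e) == (u, e'))%:R.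
Proof.
move=> Be; rewrite /cf coord_of_basis // xpair_eqE.
by case: eqP => _; rewrite ?andbF ?andbT ?mcoeff0 // mcoeff1 eq_sym.
Qed.

Lemma cf_term a e u e' : B e -> cf ('X_[a] *: e) u e' = ((a, e) == (u, e'))%:R.
Proof.
move=> Be; rewrite cfX; case: ifPn => [au|nau].
  rewrite cf_of_basis // !xpair_eqE; congr (nat_of_bool (_ && _))%:R.
  apply/eqP/eqP => [ua|->]; last by apply/mnmP => i; rewrite mnmBE subnn mnm0E.
  by rewrite -(subKm au) -ua addm0.
by case: eqP => // -[aE _]; rewrite aE lepm_refl in nau.
Qed.

Lemma basis_neq0 e : B e -> e != 0.
Proof.
move=> Be; apply/eqP => e0; have := cf_of_basis 0%MM e Be.
by rewrite eqxx e0 cf0 => /esym/eqP; rewrite oner_eq0.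
Qed.

Lemma cf_basis x u e : cf x u e != 0 -> B e.
Proof.
move=> h; apply: (@coord_basis x); apply: contra_neq h => h.
by rewrite /cf h mcoeff0.
Qed.

Lemma mem_term_seq x u e : ((u, e) \in term_seq x) = (cf x u e != 0).
Proof.
apply/allpairsPdep/idP => [[e' [u' [_ h [-> ->]]]]|h].
  by rewrite /cf -mcoeff_msupp.
exists e, u; split=> //; last by rewrite mcoeff_msupp.
by move: h; rewrite /cf /bcoord; case: ifP => //; rewrite mcoeff0 eqxx.
Qed.

Lemma term_seq_uniq x : uniq (term_seq x).
Proof.
apply: allpairs_uniq_dep => [|e _|]; [by case: (coord_expP x)|exact: msupp_uniq|].
by move=> [e u] [e' u'] _ _ /= [-> ->].
Qed.

Lemma term_seq_basis x t : t \in term_seq x -> B t.2.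
Proof. by case: t => u e; rewrite mem_term_seq => /cf_basis. Qed.

Lemma term_sum x :
  x = \sum_(t <- term_seq x) (cf x t.1 t.2)%:MP *: ('X_[t.1] *: t.2).
Proof.
rewrite /term_seq big_allpairs_dep /= {1}[x]coord_sum; apply: eq_bigr => e _.
rewrite {1}[bcoord x e]mpolyE scaler_suml; apply: eq_bigr => u _.
by rewrite scalerA mul_mpolyC.
Qed.

Lemma cf_ext x y : (forall u e, cf x u e = cf y u e) -> x = y.
Proof.
move=> h; apply/eqP; rewrite -subr_eq0 [x - y]term_sum; apply/eqP.
by apply: big1 => t _; rewrite cfB h subrr scale0r.
Qed.

Lemma cf_terms (s : seq (mon * M)) (P : pred (mon * M)) (c : mon * M -> k) u e :
  uniq s -> (forall t, t \in s -> B t.2) ->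
  cf (\sum_(t <- s | P t) (c t)%:MP *: ('X_[t.1] *: t.2)) u e =
    if ((u, e) \in s) && P (u, e) then c (u, e) else 0.
Proof.
move=> us sB; rewrite cf_sum.
have cf_t t : t \in s -> cf ((c t)%:MP *: ('X_[t.1] *: t.2)) u e =
    if t == (u, e) then c t else 0.
  case: t => v x tvs; rewrite cfC (cf_term _ _ _ (sB _ tvs)) /=.
  by case: eqP; rewrite ?mulr1 ?mulr0.
have [ts|ts] := boolP ((u, e) \in s); last first.
  rewrite big_seq_cond big1 // => t /andP[ts' _]; rewrite cf_t //.
  by case: eqP => // tE; rewrite -tE ts' in ts.
rewrite big_mkcond (bigD1_seq (u, e)) //= cf_t // eqxx.
rewrite big_seq_cond big1 ?addr0 // => t /andP[ts' /negPf tE].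
by rewrite cf_t // tE if_same.
Qed.

Lemma cf_proj P x u e : cf (proj P x) u e = if `[< P u e >] then cf x u e else 0.
Proof.
rewrite /proj (@cf_terms (term_seq x) (fun t => `[< P t.1 t.2 >])
  (fun t => cf x t.1 t.2)) ?term_seq_uniq //=; last exact: term_seq_basis.
by rewrite mem_term_seq; case: eqVneq => [->|] //=; rewrite if_same.
Qed.

Lemma syz_supportE h u e : syz_support B h u e <-> cf h u e != 0.
Proof.
split=> [[s [c [hE es]]]|h0]; first by rewrite /cf (coordE _ hE) es.
have [us sB hE] := coord_expP h.
exists (coord_exp h).1, (coord_exp h).2; split=> //; move: h0; rewrite /cf /bcoord.
  by case: ifP => //; rewrite mcoeff0 eqxx.
by case: ifP => //; rewrite mcoeff0 eqxx.
Qed.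

End Coord.

Section LinearTerms.
Variables (n : nat) (k : fieldType).
Local Notation R := {mpoly k[n]}.
Variables (M N : lmodType R) (B : M -> Prop) (B' : N -> Prop).
Hypotheses (hB : is_basis B) (hB' : is_basis B').
Variable f : {linear M -> N}.

Lemma cf_linear x u e : cf B' (f x) u e =
  \sum_(t <- term_seq B x) cf B x t.1 t.2 * cf B' ('X_[t.1] *: f t.2) u e.
Proof.
rewrite {1}(term_sum hB x) linear_sum cf_sum //; apply: eq_bigr => t _.
by rewrite !linearZ /= cfC.
Qed.

(** A nonzero sum has a nonzero summand. Terms are traced back through the differential in this
    way. *)
Lemma cf_linear_ex x u e : cf B' (f x) u e != 0 ->
  exists v y, [/\ B y, cf B x v y != 0, (v <= u)%MM & cf B' (f y) (u - v)%MM e != 0].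
Proof.
rewrite cf_linear => h.
have [t tx h'] : exists2 t, t \in term_seq B x &
    cf B' ('X_[t.1] *: f t.2) u e != 0.
  apply: contrapT => hn; case/eqP: h; rewrite big_seq big1 // => t tx.
  case: (eqVneq (cf B' ('X_[t.1] *: f t.2) u e) 0) => [->|tn0]; first by rewrite mulr0.
  by case: hn; exists t.
exists t.1, t.2; move: h'; rewrite cfX //; case: ifP; rewrite ?eqxx // => tu h'.
by split=> //; [exact: (term_seq_basis hB tx)|rewrite -mem_term_seq // -surjective_pairing].
Qed.

End LinearTerms.

(** * Graded modules and the lattice ideal *)

Section Graded.
Variables (n : nat) (k : fieldType) (L : zmodClosed 'rV[int]_n).
Local Notation R := {mpoly k[n]}.
Local Notation mon := 'X_{1..n}.
Local Notation degA := (degA L).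
Variables (M : lmodType R) (hom : deg_group L -> M -> Prop) (B : M -> Prop).
Hypotheses (gM : is_grading hom) (hB : is_basis B).
Hypothesis homB : forall e, B e -> homogeneous hom e.

Definition bdeg (e : M) : deg_group L :=
  if pselect (homogeneous hom e) is left h then sval (cid h) else 0.

Lemma bdegP e : B e -> hom (bdeg e) e.
Proof. by move/homB; rewrite /bdeg; case: pselect => // h _; case: (cid h). Qed.

Lemma homN b x : hom b x -> hom b (- x).
Proof. by rewrite -sub0r; apply: (gradingB gM); exact: grading0. Qed.

Lemma homD b x y : hom b x -> hom b y -> hom b (x + y).
Proof. by move=> hx hy; rewrite -[y]opprK; apply: (gradingB gM) => //; exact: homN. Qed.

Lemma hom_sum b I (r : seq I) (P : pred I) (f : I -> M) :
  (forall i, P i -> hom b (f i)) -> hom b (\sum_(i <- r | P i) f i).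
Proof. by move=> h; elim/big_ind: _ => //; [exact: grading0|exact: homD]. Qed.

Lemma homC b c x : hom b x -> hom b (c%:MP *: x).
Proof.
move=> hx; rewrite -[b]add0r; apply: (gradingZ gM) hx => u.
rewrite mcoeff_msupp mcoeffC; case: (u =P 0%MM) => [->|_]; rewrite ?degA0 //.
by rewrite mulr0 eqxx.
Qed.

Lemma homX b u x : hom b x -> hom (degA u + b) ('X_[u] *: x).
Proof.
by apply: (gradingZ gM) => v; rewrite msuppX inE => /eqP->.
Qed.

Lemma cf_hom b x : (forall u e, cf B x u e != 0 -> degA u + bdeg e = b) -> hom b x.
Proof.
move=> h; rewrite [x](term_sum hB) big_seq; apply: hom_sum => -[u e].
rewrite mem_term_seq // => ue; rewrite -(h _ _ ue) /=; apply/homC/homX/bdegP.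
exact: cf_basis ue.
Qed.

(** The parts of x of the various degrees add up to x. Subtracting x in degree b gives a vanishing
    sum of homogeneous elements of distinct degrees, so directness kills every part of degree other
    than b. *)
Lemma hom_cf b x u e : hom b x -> cf B x u e != 0 -> degA u + bdeg e = b.
Proof.
move=> hx ue; apply/eqP; apply: contraT => nb.
pose dg (t : mon * M) := degA t.1 + bdeg t.2.
pose f c := proj B (fun u e => degA u + bdeg e = c) x - (if c == b then x else 0).
have hf c : hom c (f c).
  apply: (gradingB gM); last by case: eqP => [->|_] //; exact: grading0.
  by apply: cf_hom => v y; rewrite cf_proj //; case: asboolP; rewrite ?eqxx.
pose s := undup (b :: map dg (term_seq B x)).
have sum0 : \sum_(c <- s) f c = 0.
  have bs : b \in s by rewrite mem_undup mem_head.
  have sumx : \sum_(c <- s) (if c == b then x else 0) = x.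
    rewrite (bigD1_seq b) ?undup_uniq //= eqxx.
    by rewrite big1 ?addr0 // => c /negPf->.
  rewrite sumrB sumx; apply/eqP; rewrite subr_eq0.
  apply/eqP; apply: (cf_ext hB) => v y; rewrite cf_sum //.
  case: (eqVneq (cf B x v y) 0) => [z|nz].
    by rewrite big1 // => c _; rewrite cf_proj // z if_same.
  rewrite (bigD1_seq (dg (v, y))) ?undup_uniq //=; last first.
    by rewrite mem_undup inE map_f ?orbT // mem_term_seq.
  rewrite cf_proj // asboolT // big1 ?addr0 // => c cne; rewrite cf_proj // asboolF //.
  by move=> vc; rewrite -vc eqxx in cne.
have cs : dg (u, e) \in s by rewrite mem_undup inE map_f ?orbT // mem_term_seq.
have := grading_direct gM (undup_uniq _) hf sum0 cs.
move/(congr1 (fun z => cf B z u e)); rewrite /f (negPf nb) subr0 cf_proj // asboolT //.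
by rewrite cf0 // => /eqP; rewrite (negPf ue).
Qed.

Lemma bdeg_fiber e : B e -> exists w, degA w = bdeg e.
Proof.
move=> Be; have := grading_supp gM (bdegP Be) (basis_neq0 hB Be).
by case/in_deg_semigroupP => w /eqP; exists w.
Qed.

Lemma divX_ex (l : 'I_n) x : (forall u e, cf B x u e != 0 -> u l != 0%N) ->
  exists y, x = 'X_l *: y.
Proof.
move=> h; exists (\sum_(t <- term_seq B x)
  (cf B x t.1 t.2)%:MP *: ('X_[t.1 - U_(l)] *: t.2)).
rewrite {1}[x](term_sum hB) scaler_sumr; apply: eq_big_seq => -[u e].
rewrite mem_term_seq // => /h ul /=; rewrite !scalerA mulrAC -mpolyXD mulrC subKm //.
by rewrite lep1mP.
Qed.

Lemma mulX_inj (l : 'I_n) (x : M) : 'X_l *: x = 0 -> x = 0.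
Proof.
move=> x0; apply: (cf_ext hB) => u e; rewrite cf0 //.
have := cfX hB U_(l) x (U_(l) + u)%MM e.
by rewrite x0 cf0 // lem_addr addKm => <-.
Qed.

End Graded.

Section LatticeIdeal.
Variables (n : nat) (k : fieldType) (L : zmodClosed 'rV[int]_n).
Local Notation R := {mpoly k[n]}.

(** Evaluation at (1, ..., 1). Its vanishing is necessary for membership in the lattice ideal, and
    sufficient for homogeneous polynomials. *)
Definition sum_coeff (p : R) : k := p.@[fun=> 1].

Lemma sum_coeffX u : sum_coeff 'X_[u] = 1.
Proof. by rewrite /sum_coeff mevalX big1 // => i _; rewrite expr1n. Qed.

Lemma ideal_sum_coeff (p : R) : p \in @lattice_ideal n k L -> sum_coeff p = 0.
Proof.
case/lattice_idealP => s [sL ->]; rewrite /sum_coeff rmorph_sum big_seq big1 // => f.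
move=> /sL[u [v [_ ->]]]; rewrite rmorphM rmorphB /=.
by rewrite [X in _ * (X - _)]sum_coeffX [X in _ * (_ - X)]sum_coeffX subrr mulr0.
Qed.

Lemma homog_ideal b (p : R) : homog_poly (b : deg_group L) p -> sum_coeff p = 0 ->
  p \in @lattice_ideal n k L.
Proof.
move=> hp p0; case E: (msupp p) => [|u0 s].
  by have -> : p = 0; [apply/eqP; rewrite -msupp_eq0 E|exact: rpred0].
(* The correction terms add up to the coefficient sum times the monomial of [u0], which is 0. *)
have -> : p = \sum_(u <- msupp p) (p@_u)%:MP * ('X_[u] - 'X_[u0]).
  under eq_bigr do rewrite mulrBr.
  rewrite sumrB -mulr_suml -rmorph_sum /=.
  have -> : \sum_(u <- msupp p) p@_u = sum_coeff p.
    rewrite /sum_coeff mevalE; apply: eq_bigr => u _.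
    by rewrite big1 ?mulr1 // => i _; rewrite expr1n.
  rewrite p0 mpolyC0 mul0r subr0 {1}[p]mpolyE.
  by apply: eq_bigr => u _; rewrite mul_mpolyC.
rewrite big_seq; apply: rpred_sum => u up; apply: lattice_idealMl.
apply/lattice_idealP; exists [:: (1, 'X_[u] - 'X_[u0])]; split.
  move=> f; rewrite inE => /eqP-> /=; exists u, u0; split=> //.
  by rewrite -degA_eq (hp _ up) (hp u0) // E mem_head.
by rewrite big_seq1 mul1r.
Qed.

End LatticeIdeal.

(** * The boundary of a set of monomials *)

Section LexOrder.
Variable n : nat.
Local Notation mon := 'X_{1..n}.
Implicit Types (a u v w m : mon) (S T : {fset mon}).

Let lexi (s t : seq nat) : bool := ((s : seqlexi nat) <= (t : seqlexi nat))%O.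

Lemma lex_leE u v :
  lex_le u v = lexi [seq u i | i <- enum 'I_n] [seq v i | i <- enum 'I_n].
Proof. by rewrite /lex_le /lexi -!(map_tnth_enum (val _)). Qed.

Lemma lex_le_add2l a u v : lex_le (a + u)%MM (a + v)%MM = lex_le u v.
Proof.
rewrite !lex_leE /lexi; elim: (enum 'I_n) => //= i s IH.
by rewrite !lexi_cons IH !mnmDE !leEnat !leq_add2l.
Qed.

Lemma lex_le_total : total (@lex_le n).
Proof. by move=> u v; exact: le_total. Qed.

Lemma lex_le_trans : transitive (@lex_le n).
Proof. by move=> u v w; exact: le_trans. Qed.

Lemma lex_le_anti : antisymmetric (@lex_le n).
Proof. by move=> u v /le_anti /val_inj/val_inj. Qed.

Definition lex_lt u v : bool := lex_le u v && (u != v).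

Lemma lex_ltNge u v : u != v -> lex_lt v u = ~~ lex_lt u v.
Proof.
move=> uv; rewrite /lex_lt uv eq_sym uv !andbT.
case: (boolP (lex_le u v)) => h; last by have := lex_le_total u v; rewrite (negPf h) => /= ->.
by apply/negP => h'; case/eqP: uv; apply: lex_le_anti; rewrite h h'.
Qed.

(** The position counted from 0, without sorting, so that removing an element or dividing by a
    monomial is easy to follow. The sign of m is (-1) to this power. *)
Definition lex_rank m T : nat := count (lex_lt^~ m) T.

Lemma positionE m T : m \in T -> position m T = (lex_rank m T).+1.
Proof.
move=> mT; rewrite /position /lex_rank.
have /permP<- : perm_eq (sort (@lex_le n) T) T by rewrite perm_sort.
congr _.+1; have := sort_sorted lex_le_total T.
have : m \in sort (@lex_le n) T by rewrite mem_sort.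
elim: (sort _ _) => //= x s IH; rewrite inE => /orP[/eqP->|ms] pth.
  rewrite eqxx /lex_lt eqxx andbF add0n; apply/esym/eqP; rewrite -leqn0 leqNgt -has_count.
  apply/hasPn => y ys; have /allP/(_ _ ys) xy := order_path_min lex_le_trans pth.
  by apply/negP => /andP[yx /eqP[]]; apply: lex_le_anti; rewrite xy yx.
case: eqP => [xm|/eqP xm].
  subst x; rewrite /lex_lt eqxx andbF add0n; apply/esym/eqP; rewrite -leqn0 leqNgt -has_count.
  apply/hasPn => y ys; have /allP/(_ _ ys) xy := order_path_min lex_le_trans pth.
  by apply/negP => /andP[yx /eqP[]]; apply: lex_le_anti; rewrite xy yx.
rewrite IH ?(path_sorted pth) // /lex_lt xm andbT.
by have /allP/(_ _ ms) -> := order_path_min lex_le_trans pth.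
Qed.

Lemma lex_rankD1 m m' T : m \in T -> lex_rank m' T = (lex_lt m m' + lex_rank m' (T `\ m))%N.
Proof.
move=> mT; rewrite /lex_rank -/(count (lex_lt^~ m') (m :: T `\ m)).
apply/permP/uniq_perm => [||x]; rewrite ?fset_uniq //= ?fset_uniq ?andbT.
  by rewrite !inE eqxx.
by rewrite !inE; case: eqP => [->|].
Qed.

Lemma lex_rank_translate a m T : {in T, forall x, (a <= x)%MM} -> (a <= m)%MM ->
  lex_rank (m - a)%MM (translate a T) = lex_rank m T.
Proof.
move=> aT am; rewrite /lex_rank.
have /permP-> : perm_eq (translate a T) [seq (x - a)%MM | x <- T].
  apply: uniq_perm => [||x]; first exact: fset_uniq.
    rewrite map_inj_in_uniq ?fset_uniq // => x y xT yT /(congr1 (fun w => a + w)%MM).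
    by rewrite !subKm ?aT.
  by apply/imfsetP/mapP => -[y yT ->]; exists y.
rewrite count_map; apply: eq_in_count => x xT /=; rewrite /lex_lt.
rewrite -(lex_le_add2l a) (subKm am) (subKm (aT _ xT)); congr (_ && ~~ _).
apply/eqP/eqP => [/(congr1 (fun w => a + w)%MM)|-> //].
by rewrite (subKm am) (subKm (aT _ xT)).
Qed.

End LexOrder.

Section Boundary.
Variables (n : nat) (k : fieldType).
Local Notation R := {mpoly k[n]}.
Local Notation mon := 'X_{1..n}.
Variables (V : lmodType R) (f : {fset mon} -> V).
Implicit Types (m x : mon) (S T : {fset mon}).

Definition sg m T : R := (-1) ^+ lex_rank m T.

Lemma sgE m T : sg m T = ((-1) ^+ lex_rank m T)%:MP.
Proof. by rewrite /sg rmorphXn rmorphN1. Qed.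

(** With [f] left free, the same formula serves for theta(E_C) and for its image in a resolution. *)
Definition bd T : V :=
  \sum_(m <- T) sg m T *: ('X_[gcd_set (T `\ m)] *: f (bracket (T `\ m))).

Lemma fsetD1_neq0 m T : (1 < #|` T|)%N -> T `\ m != fset0.
Proof.
by rewrite -cardfs_gt0 (cardfsD1 m T); case: (m \in T) => //; rewrite add0n => /ltnW.
Qed.

Lemma sg_bracket m T : m \in T -> sg (m - gcd_set T)%MM (bracket T) = sg m T.
Proof.
by move=> mT; rewrite /sg lex_rank_translate ?gcd_set_le // => x /gcd_set_le.
Qed.

Lemma big_bracket T (G : mon -> V) :
  \sum_(x <- bracket T) G x = \sum_(m <- T) G (m - gcd_set T)%MM.
Proof.
rewrite -(big_map (fun m => m - gcd_set T)%MM xpredT); apply: perm_big.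
apply: uniq_perm => [||x]; first exact: fset_uniq.
  rewrite map_inj_in_uniq ?fset_uniq // => x y xT yT.
  by move/(congr1 (fun w => gcd_set T + w)%MM); rewrite !subKm ?gcd_set_le.
by apply/imfsetP/mapP => -[y yT ->]; exists y.
Qed.

(** Division by gcd(T) respects the lexicographic order, hence the signs, and keeps the brackets of
    the facets. Only the monomial coefficients lose the factor gcd(T). *)
Lemma bd_bracket T : (1 < #|` T|)%N -> 'X_[gcd_set T] *: bd (bracket T) = bd T.
Proof.
move=> T1; rewrite /bd big_bracket scaler_sumr; apply: eq_big_seq => m mT.
have aT : {in T `\ m, forall x, (gcd_set T <= x)%MM} by move=> x /fsetD1P[_ /gcd_set_le].
rewrite sg_bracket // bracketD1 // bracket_translate ?fsetD1_neq0 //.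
rewrite !scalerA -mulrA mulrCA -mpolyXD.
by rewrite gcd_set_translate // fsetD1_neq0.
Qed.

Lemma big_fsetD1_cond m T (G : mon -> V) :
  \sum_(x <- T `\ m) G x = \sum_(x <- T | x != m) G x.
Proof.
rewrite -[RHS]big_filter; apply: perm_big.
apply: uniq_perm; rewrite ?filter_uniq ?fset_uniq // => x.
by rewrite mem_filter !inE.
Qed.

Lemma sg_antisym m m' T : m \in T -> m' \in T -> lex_lt m m' ->
  sg m' T * sg m (T `\ m') = - (sg m T * sg m' (T `\ m)).
Proof.
move=> mT m'T mm'; have ne : m' != m by case/andP: mm' => _; rewrite eq_sym.
rewrite /sg (lex_rankD1 m' mT) (lex_rankD1 m m'T) mm' (lex_ltNge (u := m)) ?mm' 1?eq_sym //.
by rewrite add0n add1n exprS mulN1r mulNr mulrC.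
Qed.

(** Removing m and m' in either order gives the same face with opposite signs. Hence the double sum
    has the antisymmetric form H(m, m') - H(m', m). *)
Lemma bd_bd T : \sum_(m <- T) sg m T *: bd (T `\ m) = 0.
Proof.
pose G m m' := (sg m T * sg m' (T `\ m)) *:
  ('X_[gcd_set (T `\ m `\ m')] *: f (bracket (T `\ m `\ m'))).
transitivity (\sum_(m <- T) \sum_(m' <- T | m' != m) G m m').
  apply: eq_bigr => m _; rewrite -big_fsetD1_cond scaler_sumr.
  by apply: eq_bigr => m' _; rewrite scalerA.
pose H m m' := if lex_lt m m' then G m m' else 0.
transitivity (\sum_(m <- T) \sum_(m' <- T) (H m m' - H m' m)).
  apply: eq_big_seq => m mT; rewrite big_mkcond; apply: eq_big_seq => m' m'T.
  rewrite /H; case: eqVneq => [->|ne] /=; first by rewrite /lex_lt eqxx andbF subrr.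
  rewrite (lex_ltNge (u := m)) 1?eq_sym //; case: ifPn => /= [lt|nlt]; first by rewrite subr0.
  have lt : lex_lt m' m by rewrite (lex_ltNge (u := m)) 1?eq_sym.
  have swap : T `\ m `\ m' = T `\ m' `\ m by rewrite !fsetDDl fsetUC.
  by rewrite sub0r /G swap (sg_antisym m'T mT lt) scaleNr.
under eq_bigr do rewrite sumrB.
by rewrite sumrB [X in _ - X]exchange_big subrr.
Qed.

End Boundary.

(** * The generalized algebraic Scarf complex *)

Section ScarfComplex.
Variables (n : nat) (L : zmodClosed 'rV[int]_n) (k : fieldType).
Local Notation R := {mpoly k[n]}.
Local Notation mon := 'X_{1..n}.
Local Notation degA := (degA L).
Local Notation idx := (basic_index L).
Local Notation G := (scarf_module L k).
Local Notation elt j := (@scarf_elt n L k j).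
Local Notation theta := (@scarf_theta n L k).

Lemma basic_indexP j (C : idx j) :
  basic_fiber_component L (val C) /\ #|` val C| = j.+1.
Proof. by have /andP[/asboolP bC /eqP] := valP C. Qed.

(** Since [bd] evaluates on raw sets, [f] is continued by 0. By [basic_face] the default is not met
    on facets of components with [j.+2] elements. *)
Definition extend j (V : lmodType R) (f : idx j -> V) (S : {fset mon}) : V :=
  if insub S is Some c then f c else 0.

Lemma extend_val j (V : lmodType R) (f : idx j -> V) (C : idx j) : extend f (val C) = f C.
Proof. by rewrite /extend valK. Qed.

Lemma basic_index_ex j S : basic_fiber_component L S -> #|` S| = j.+1 ->
  exists C : idx j, val C = S.
Proof.
move=> bS cS; have h : `[< basic_fiber_component L S >] && (#|` S| == j.+1).
  by rewrite cS eqxx andbT; apply/asboolP.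
by exists (Sub S h); rewrite SubK.
Qed.

Lemma scarf_elt_val j (C : idx j) : elt j (val C) = << C >>.
Proof. by rewrite /scarf_elt valK. Qed.

Lemma scarf_sum j (x : G j) : x = \sum_(C <- dom x) coeff C x *: (<< C >> : G j).
Proof.
rewrite -[LHS]freeg_sumE; apply: eq_bigr => C _.
by apply/eqP/freeg_eqP => C'; rewrite coeffZ !coeffU mul1r.
Qed.

Section Lift.
Variables (j : nat) (V : lmodType R) (f : idx j -> V).

Definition scarf_lift (x : G j) : V := fglift f x.

Fact scarf_lift_is_linear : linear scarf_lift.
Proof.
have subD : {morph scarf_lift : x y / x - y} by exact: (lift_is_additive f).
have D0 : scarf_lift 0 = 0 by rewrite -(subrr 0) subD subrr.
have addD : {morph scarf_lift : x y / x + y}.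
  by move=> x y; rewrite -[y in LHS]opprK subD -[- y]sub0r subD D0 sub0r opprK.
move=> a x y; rewrite addD; congr (_ + _).
have -> : x = \sum_(C <- dom x) << coeff C x *g C >> by rewrite freeg_sumE.
rewrite scaler_sumr !(big_morph _ addD D0) scaler_sumr; apply: eq_bigr => C _.
have -> : a *: (<< coeff C x *g C >> : G j) = << a * coeff C x *g C >>.
  by apply/eqP/freeg_eqP => C'; rewrite coeffZ !coeffU mulrA.
by rewrite /scarf_lift !liftU scalerA.
Qed.

HB.instance Definition _ := GRing.isLinear.Build R (G j) V *:%R scarf_lift
  scarf_lift_is_linear.

Lemma scarf_liftU C : scarf_lift << C >> = f C.
Proof. by rewrite /scarf_lift liftU scale1r. Qed.

Lemma scarf_lift_elt S : scarf_lift (elt j S) = extend f S.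
Proof.
rewrite /scarf_elt /extend; case: insub => [c|]; first exact: scarf_liftU.
exact: linear0.
Qed.

End Lift.

Lemma scarf_diff_eltE j (C : idx j.+1) : scarf_diff_elt k C = bd (elt j) (val C).
Proof.
apply: eq_big_seq => m mC; rewrite positionE // /sg.
by rewrite exprS mulN1r exprS mulN1r opprK.
Qed.

Lemma thetaU j (C : idx j.+1) : theta j << C >> = bd (elt j) (val C).
Proof. by rewrite -scarf_diff_eltE /= /scarf_diff liftU scale1r. Qed.

Lemma scarf_lift_theta j (V : lmodType R) (f : idx j -> V) (C : idx j.+1) :
  scarf_lift f (theta j << C >>) = bd (extend f) (val C).
Proof.
rewrite thetaU /bd linear_sum; apply: eq_bigr => m _.
rewrite linearZ; congr (_ *: _); rewrite linearZ; congr (_ *: _).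
exact: scarf_lift_elt.
Qed.

Lemma basic_face j (C : idx j.+1) m : m \in val C ->
  exists C' : idx j, val C' = bracket (val C `\ m).
Proof.
move=> mC; have [[b bC] cC] := basic_indexP C.
have C1 : (1 < #|` val C|)%N by rewrite cC.
apply: basic_index_ex; last first.
  by rewrite card_bracket; have := cardfsD1 m (val C); rewrite mC cC add1n => -[<-].
by apply: (face_basic bC); [exact: fsetD1_neq0|exact: fsubD1set].
Qed.

Lemma theta_theta j (x : G j.+2) : theta j (theta j.+1 x) = 0.
Proof.
rewrite [x]scarf_sum !linear_sum big1 // => C _; rewrite 2!linearZ.
suff -> : theta j (theta j.+1 << C >>) = 0 by exact: scaler0.
rewrite thetaU.
transitivity (\sum_(m <- val C) sg k m (val C) *: bd (elt j) (val C `\ m));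
  last exact: bd_bd.
rewrite {1}/bd linear_sum; apply: eq_big_seq => m mC.
have [C' eC'] := basic_face mC; have [_ cC'] := basic_indexP C'.
rewrite linearZ; congr (_ *: _); rewrite linearZ -bd_bracket; last first.
  by rewrite -card_bracket -eC' cC'.
congr (_ *: _); rewrite -eC' scarf_elt_val; exact: thetaU.
Qed.

Local Notation hom := (@scarf_hom n L k).

Lemma val_index_ex j (C : idx j) : exists m, m \in val C.
Proof.
by have [_ cC] := basic_indexP C; apply/fset0Pn; rewrite -cardfs_gt0 cC.
Qed.

Lemma index_deg j (C : idx j) m m' : m \in val C -> m' \in val C -> degA m = degA m'.
Proof.
have [[b /basic_sphere sC] _] := basic_indexP C.
by move=> /(sphere_deg sC)-> /(sphere_deg sC)->.
Qed.

Definition index_degree j (C : idx j) : deg_group L :=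
  degA (xchoose (val_index_ex C)).

Lemma index_degreeE j (C : idx j) m : m \in val C -> degA m = index_degree C.
Proof. move=> mC; apply: index_deg mC _; exact: (xchooseP (val_index_ex C)). Qed.

Lemma scarf_homE j b (x : G j) : hom b x <->
  forall C u, u \in msupp (coeff C x) -> degA u + index_degree C = b.
Proof.
split=> h C u => [uC|m uC mC]; last by rewrite (index_degreeE mC); exact: h uC.
have [m mC] := val_index_ex C; rewrite -(index_degreeE mC); exact: h uC mC.
Qed.

Lemma scarf_is_grading j : is_grading (@scarf_hom n L k j).
Proof.
split=> [b|b x y|a b p x hp|b x|x|s f us hf sum0 b bs].
- by apply/scarf_homE => C u; rewrite coeff0 msupp0.
- move=> /scarf_homE hx /scarf_homE hy; apply/scarf_homE => C u.
  by rewrite coeffB => /msuppB_le; rewrite mem_cat => /orP[/hx|/hy].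
- move=> /scarf_homE hx; apply/scarf_homE => C u.
  rewrite coeffZ => /msuppM_le/allpairsP[[v w] /= [vp wx ->]].
  by rewrite degAD -addrA (hx _ _ wx) (hp _ vp).
- move=> /scarf_homE hx x0; have [C /eqP Cx] : exists C, coeff C x <> 0.
    apply: contrapT => h; case/eqP: x0; apply/eqP/freeg_eqP => C; rewrite coeff0.
    by apply: contrapT => hC; apply: h; exists C.
  have [u ux] : exists u, u \in msupp (coeff C x).
    case E: (msupp (coeff C x)) => [|u s]; last by exists u; rewrite mem_head.
    by move: Cx; rewrite -msupp_eq0 E.
  have [m mC] := val_index_ex C; apply/in_deg_semigroupP; exists (u + m)%MM.
  by rewrite in_fiber degAD (index_degreeE mC) (hx _ _ ux).
- pose s := undup [seq degA u + index_degree C | C <- dom x, u <- msupp (coeff C x)].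
  pose f b : G j := \sum_(C <- dom x) \sum_(u <- msupp (coeff C x) |
    degA u + index_degree C == b) ((coeff C x)@_u *: 'X_[u]) *: (<< C >> : G j).
  exists s, f; split=> [|b|]; first exact: undup_uniq.
    apply/scarf_homE => C v; rewrite mcoeff_msupp => h.
    suff : exists2 u, u = v & degA u + index_degree C = b by case=> u ->.
    apply: contrapT => hn; case/eqP: h; rewrite !raddf_sum big1 // => C' _.
    rewrite raddf_sum; rewrite raddf_sum big1 // => u /eqP ub.
    rewrite /= coeffZ coeffU mul1r; case: eqP => [CC|_]; last by rewrite mulr0 mcoeff0.
    rewrite mulr1 mcoeffZ mcoeffX; case: eqP => [uv|_]; last by rewrite mulr0.
    by case: hn; exists u => //; rewrite -CC.
  rewrite /f exchange_big /= [LHS]scarf_sum; apply: eq_big_seq => C Cx.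
  rewrite {1}[coeff C x]mpolyE scaler_suml.
  under [RHS]eq_bigr do rewrite big_mkcond.
  rewrite [RHS]exchange_big; apply: eq_big_seq => u uC.
  rewrite (bigD1_seq (degA u + index_degree C)) ?undup_uniq //; last first.
    by rewrite mem_undup; apply/allpairsPdep; exists C, u.
  rewrite eqxx big1; first exact/esym/addr0.
  by move=> b /negPf; rewrite eq_sym => ->.
apply/eqP/freeg_eqP => C; rewrite coeff0; apply/mpolyP => u; rewrite mcoeff0.
have hz c : c != degA u + index_degree C -> (coeff C (f c))@_u = 0.
  move=> cne; apply/eqP; rewrite mcoeff_eq0; apply: contraNN cne.
  by move/(scarf_homE _ _).1: (hf c) => h /h ->.
case: (eqVneq b (degA u + index_degree C)) => [be|/hz //].
move/(congr1 (fun z => (coeff C z)@_u)): sum0; rewrite coeff0 mcoeff0 => <-.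
rewrite !raddf_sum (bigD1_seq b) //= big1 ?addr0 // => c cb; apply: hz.
by rewrite -be.
Qed.

Lemma scarf_homU j (C : idx j) : hom (index_degree C) (<< C >> : G j).
Proof.
apply/scarf_homE => C' u; rewrite coeffU mul1r; case: eqP => [<-|_]; last by rewrite msupp0.
by rewrite msupp1 inE => /eqP->; rewrite degA0 add0r.
Qed.

Lemma scarf_theta_hom j b (x : G j.+1) : hom b x -> hom b (theta j x).
Proof.
move=> /scarf_homE hx; rewrite [x]scarf_sum linear_sum big_seq.
apply: (hom_sum (scarf_is_grading j)) => C Cx; rewrite linearZ.
rewrite -[b](subrK (index_degree C)); apply: (gradingZ (scarf_is_grading j)).
  by move=> u /hx <-; rewrite addrK.
rewrite thetaU /bd big_seq; apply: (hom_sum (scarf_is_grading j)) => m mC.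
have [C' eC'] := basic_face mC; rewrite -eC' scarf_elt_val.
rewrite sgE.
apply: (homC (scarf_is_grading j)).
have [w wC'] := val_index_ex C'.
have -> : index_degree C = degA (gcd_set (val C `\ m)) + index_degree C'.
  rewrite -(index_degreeE wC') -degAD; apply/esym/index_degreeE.
  move: wC'; rewrite eC' mem_bracket; last first.
    by rewrite fsetD1_neq0 // (basic_indexP C).2.
  by case/fsetD1P.
exact/(homX (scarf_is_grading j))/scarf_homU.
Qed.

Lemma scarf_graded_complex : graded_complex hom theta.
Proof.
split; [exact: scarf_is_grading|exact: scarf_theta_hom|exact: theta_theta].
Qed.

End ScarfComplex.

(** * Minimal simple resolutions *)

Section Resolution.
Variables (n : nat) (k : fieldType) (L : zmodClosed 'rV[int]_n).
Hypothesis L_pos : forall v : 'rV[int]_n, v \in L -> (forall i, 0 <= v 0 i) -> v = 0.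
Local Notation R := {mpoly k[n]}.
Local Notation mon := 'X_{1..n}.
Local Notation degA := (degA L).
Variables (F : nat -> lmodType R) (hom : forall j, deg_group L -> F j -> Prop).
Variables (phi : forall j, {linear F j.+1 -> F j}).
Variables (phi0 : {linear F 0 -> lattice_quot k L}) (B : forall j, F j -> Prop).
Arguments B : clear implicits.
Hypothesis res : graded_resolution hom phi phi0.
Hypothesis homB : forall j, homogeneous_basis hom (B j).
Hypothesis minF : minimal_resolution phi.

Local Notation cf j := (cf (B j)).
Local Notation bdeg := (bdeg (@hom _)).
Local Notation syz := (syzygy phi phi0).

(** The positivity of the lattice enters here: the exponent vector of u is a nonnegative element of
    L. *)
Lemma degA_eq0 u : degA u = 0 -> u = 0%MM.
Proof.
rewrite -(degA0 L) => /eqP; rewrite degA_eq => uL.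
have := L_pos uL _; move=> h; apply/mnmP => i.
have /rowP/(_ i) : expv u - expv 0%MM = 0.
  by apply: h => l; rewrite !mxE mnm0E subr0.
by rewrite !mxE mnm0E subr0 => -[].
Qed.

Let isB j : is_basis (B j) := (homB j).1.
Let hB j e (Be : B j e) : homogeneous (@hom j) e := (homB j).2 e Be.
Let gF j : is_grading (@hom j) := res_grading res j.

Lemma binomial_coef0 (p : R) : lattice_binomial L p -> p@_0 = 0.
Proof.
case=> u [v [uv ->]]; rewrite mcoeffB !mcoeffX.
have uv_deg : degA u = degA v by apply/eqP; rewrite degA_eq.
case: (eqVneq u 0%MM) => [u0|u0]; case: (eqVneq v 0%MM) => [v0|v0]; rewrite ?subrr //.
  by move: v0; rewrite (degA_eq0 (u := v)) ?eqxx // -uv_deg u0 degA0.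
by move: u0; rewrite (degA_eq0 (u := u)) ?eqxx // uv_deg v0 degA0.
Qed.

Lemma ideal_coef0 (p : R) : p \in @lattice_ideal n k L -> p@_0 = 0.
Proof.
case/lattice_idealP => s [sL ->]; rewrite raddf_sum big_seq big1 // => f /sL fL.
by rewrite /= (rmorphM (mcoeff 0%MM)) /= (binomial_coef0 fL) mulr0.
Qed.

(** Minimality in usable form: a cycle is a boundary by exactness, so it lies in (x_1, ..., x_n) F_j
    and has no constant coefficients. *)
Lemma syz_coef0 j (x : F j) e : syz x -> cf j x 0%MM e = 0.
Proof.
move=> /(res_exact res)[y <-]; have [z ->] := minF y.
rewrite cf_sum // big1 // => i _; rewrite cfX // lep1mP mnm0E.
by [].
Qed.

Lemma phi_coef0 j (x : F j.+1) e : cf j (phi j x) 0%MM e = 0.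
Proof. by apply: syz_coef0; apply/(res_exact res); exists x. Qed.

Lemma bdegB j (e : F j) : B j e -> hom (bdeg e) e.
Proof. exact: (bdegP (@hB j)). Qed.

Lemma phi_deg j (e : F j.+1) u y : B j.+1 e -> cf j (phi j e) u y != 0 ->
  degA u + bdeg y = bdeg e.
Proof.
move=> Be; apply: (hom_cf (gF j) (isB j) (@hB j)); apply: (res_phi_hom res).
exact: bdegB.
Qed.

Lemma basis_not_syz j (e : F j) : B j e -> ~ syz e.
Proof.
move=> Be /(syz_coef0 e)/eqP; rewrite cf_of_basis // eqxx oner_eq0; by [].
Qed.

Lemma phi_basis_neq0 j (e : F j.+1) : B j.+1 e -> phi j e != 0.
Proof. by move=> /basis_not_syz h; apply/eqP => e0; apply: h. Qed.

Lemma syzB j (x y : F j) : syz x -> syz y -> syz (x - y).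
Proof.
move=> /(res_exact res)[x' <-] /(res_exact res)[y' <-]; apply/(res_exact res).
by exists (x' - y'); rewrite linearB.
Qed.

Lemma syzZ j p (x : F j) : syz x -> syz (p *: x).
Proof.
move=> /(res_exact res)[x' <-]; apply/(res_exact res).
by exists (p *: x'); rewrite linearZ.
Qed.

Lemma syz_phi j (x : F j.+1) : syz (phi j x).
Proof. by apply/(res_exact res); exists x. Qed.

Local Notation pi := (@pi _ (lattice_quot k L)).

Lemma pi_eq0 (p : R) : (pi p == 0) = (p \in @lattice_ideal n k L).
Proof.
have <- : pi 0 = 0 by apply: (addrI (pi 0)); rewrite -quot_piD !addr0.
by rewrite quot_eqE subr0.
Qed.

Lemma scale_pi (a p : R) : a *: pi p = pi (a * p).
Proof. exact: quot_scale_pi. Qed.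

Lemma pi_sum I (r : seq I) (f : I -> R) :
  pi (\sum_(i <- r) f i) = \sum_(i <- r) pi (f i).
Proof.
apply: (big_morph pi) => [x y|]; first exact: quot_piD.
by apply: (addrI (pi 0)); rewrite -quot_piD !addr0.
Qed.

(** Comparing constant terms in a preimage of 1 yields a basis element e sent to a nonzero constant.
    Any other basis element y, corrected by the multiple of e with the same image, would be a cycle
    with constant coefficient 1 at y. *)
Lemma F0_generator : exists e : F 0, [/\ B 0 e, forall y, B 0 y -> y = e,
  bdeg e = 0 & exists2 c : k, c != 0 & phi0 e = pi c%:MP].
Proof.
have [x x1] := res_surj res (pi 1).
have pE y : B 0 y -> {p : R | homog_poly (bdeg y) p & phi0 y = pi p}.
  by move=> By; apply/cid2; apply: (res_phi0_hom res); exact: bdegB.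
pose s := (coord_exp (B 0) x).1.
pose p y := if pselect (B 0 y) is left By then s2val (pE y By) else 0.
have pP y : B 0 y -> homog_poly (bdeg y) (p y) /\ phi0 y = pi (p y).
  by move=> By; rewrite /p; case: pselect => // By'; case: (pE y By').
have [us sB xE] := coord_expP (isB 0) x.
have : 1 - \sum_(y <- s) bcoord (B 0) x y * p y \in @lattice_ideal n k L.
  rewrite -quot_eqE pi_sum -x1 {1}(coord_sum (isB 0) x) linear_sum.
  apply/eqP/eq_big_seq => y /sB /pP[_ py]; by rewrite linearZ /= py scale_pi.
move/ideal_coef0; rewrite mcoeffB mcoeff1 eqxx raddf_sum => /subr0_eq sum1.
have [e es] : exists2 e, e \in s & (bcoord (B 0) x e * p e)@_0 != 0.
  apply: contrapT => hn; case/eqP: (oner_neq0 k); rewrite [1]sum1 big_seq big1 // => y ys.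
  by apply: contrapT => /eqP h; apply: hn; exists y.
rewrite (rmorphM (mcoeff 0%MM)) mulf_eq0 negb_or => /andP[_ pe0].
have Be := sB _ es; have [hp ep] := pP _ Be.
have e0 : bdeg e = 0 by rewrite -(hp 0%MM) ?degA0 // mcoeff_msupp.
have pc : p e = ((p e)@_0)%:MP.
  apply/mpolyP => u; rewrite mcoeffC; case: (eqVneq u 0%MM) => [->|u0].
    by rewrite mulr1.
  rewrite mulr0; apply/eqP; rewrite mcoeff_eq0; apply: contraNN u0 => up.
  by apply/eqP/degA_eq0; rewrite (hp _ up).
exists e; split=> //; last by exists (p e)@_0; rewrite // -pc.
move=> y By; have [_ yp] := pP _ By; apply/eqP; apply: contraT => ye.
have : syz (y - (p y * ((p e)@_0)^-1%:MP) *: e).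
  rewrite /= linearB linearZ /= yp ep scale_pi [X in _ * X]pc -mulrA -mpolyCM.
  by rewrite mulVf // mpolyC1 mulr1 subrr.
move/(syz_coef0 y)/eqP; rewrite cfB // cf_of_basis // eqxx cfZ //.
by rewrite coord_of_basis // (eq_sym e) (negPf ye) mulr0 mcoeff0 subr0 oner_eq0.
Qed.

(** As F_0 = R e and [phi0 e] is a nonzero constant, x is a cycle exactly when its coordinate lies
    in the lattice ideal. *)
Lemma syz0_sum_coeff (e x : F 0) : B 0 e -> (forall y, B 0 y -> y = e) ->
  (exists2 c : k, c != 0 & phi0 e = pi c%:MP) ->
  (syz (x : F 0) -> sum_coeff (bcoord (B 0) x e) = 0) /\
  (forall b, hom b x -> sum_coeff (bcoord (B 0) x e) = 0 -> syz x).
Proof.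
move=> Be uniqe [c c0 ec].
have xE : x = bcoord (B 0) x e *: e.
  apply: (cf_ext (isB 0)) => u y; rewrite cfZ //.
  case: (pselect (B 0 y)) => [/uniqe->|nBy].
    by rewrite (coord_of_basis (isB 0) _ Be) eqxx mulr1.
  case: (eqVneq (cf 0 x u y) 0) => [->|]; last by move/(cf_basis (isB 0)).
  rewrite (coord_of_basis (isB 0) _ Be); case: eqP => [ey|_]; first by rewrite -ey in nBy.
  by rewrite mulr0 mcoeff0.
have phi0x : phi0 x = pi (c%:MP * bcoord (B 0) x e).
  by rewrite {1}xE linearZ /= ec scale_pi mulrC.
rewrite /= phi0x; split=> [/eqP|b hx x0]; last first.
  apply/eqP; rewrite pi_eq0; apply/lattice_idealMl/(@homog_ideal _ _ _ (b - bdeg e)) => //.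
  move=> u; rewrite mcoeff_msupp => xu.
  by rewrite -(hom_cf (gF 0) (isB 0) (@hB 0) hx xu) addrK.
rewrite pi_eq0 => /ideal_sum_coeff; rewrite /sum_coeff rmorphM /= mevalC => /eqP.
by rewrite mulf_eq0 (negPf c0) => /eqP.
Qed.

(** If x_l divided the whole fiber of the degree of e, the induction hypothesis would make x_l
    divide every term of phi(e). The quotient w is again a cycle, so w = phi(y), and e - x_l y is a
    cycle that minimality forbids. *)
Lemma no_common_divisor j (e : F j) l : B j e ->
  exists v : mon, degA v = bdeg e /\ v l = 0%N.
Proof.
elim: j e => [|j IH] e Be.
  have [e0 [_ uniq0 d0 _]] := F0_generator.
  by exists 0%MM; rewrite (uniq0 _ Be) d0 degA0 mnm0E.
apply: contrapT => hn.
have [w wE] : exists w, phi j e = 'X_l *: w.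
  apply: (divX_ex (isB j)) => u y uy; apply: contraPneq hn => ul.
  have [v [dv vl]] := IH y (cf_basis (isB j) uy); apply: contrapT.
  move=> /not_notP hn; case: hn; exists (u + v)%MM.
  by rewrite degAD dv (phi_deg Be uy) mnmDE ul vl.
have cfw u y : cf j w u y = cf j (phi j e) (U_(l) + u)%MM y.
  by rewrite wE cfX // lem_addr addKm.
(* For j > 0, multiplication by x_l is injective on F. For j = 0 the quotient [w] is homogeneous,
   and removing the factor x_l keeps the coefficient sum. *)
have [y wy] : exists y, phi j y = w.
  apply/(res_exact res); case: j => [|j] in IH e Be hn w wE cfw *; last first.
    apply: (mulX_inj (isB j) (l := l)); rewrite -linearZ -wE.
    by have := syz_phi e.
  have [e0 [B0 uniq0 _ ge0]] := F0_generator.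
  have hw : hom (bdeg e - degA U_(l)%MM) w.
    apply: (cf_hom (gF 0) (isB 0) (@hB 0)) => u y; rewrite cfw => /(phi_deg Be) <-.
    by rewrite degAD addrAC [degA U_(l)%MM + _]addrC addrK.
  have [_ /(_ _ hw)] := syz0_sum_coeff w B0 uniq0 ge0; apply.
  have [/(_ (syz_phi e)) + _] := syz0_sum_coeff (phi 0 e) B0 uniq0 ge0.
  rewrite wE -[_ *: w]addr0 coordL // /sum_coeff mevalD mevalM mevalXU mul1r.
  suff -> : bcoord (B 0) 0 e0 = 0 by rewrite meval0 addr0.
  by apply/mpolyP => u; rewrite mcoeff0; exact: cf0.
have : syz (e - 'X_l *: y) by rewrite /= linearB linearZ /= wy wE subrr.
move/(syz_coef0 e)/eqP; rewrite cfB // cf_of_basis // eqxx cfX // lep1mP mnm0E.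
by rewrite subr0 oner_eq0.
Qed.

Lemma basis_fiber_neq0 j (e : F j) : B j e -> exists w, degA w = bdeg e.
Proof. exact: (bdeg_fiber (gF j) (isB j) (@hB j)). Qed.

Hypothesis simF : simple_resolution hom phi phi0 B.

Local Notation idx := (basic_index L).
Implicit Types (b : deg_group L) (u v w : mon) (S T D : {fset mon}).

Lemma cf_neq0_ex j (z : F j) : z != 0 -> exists u y, cf j z u y != 0.
Proof.
move=> z0; apply: contrapT => h; case/eqP: z0; apply: (cf_ext (isB j)) => u y.
by rewrite cf0 //; apply: contrapT => /eqP uy; apply: h; exists u, y.
Qed.

Lemma cf_basisB j (z : F j) u y : cf j z u y != 0 -> B j y.
Proof. exact: cf_basis. Qed.

(** * Terms of the resolution supported in a basic component *)

Definition upper D u : {fset mon} := [fset m in D | (u <= m)%MM].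

Lemma mem_upper D u m : (m \in upper D u) = (m \in D) && (u <= m)%MM.
Proof. by rewrite !inE. Qed.

Lemma upper_sub D u : upper D u `<=` D.
Proof. by apply/fsubsetP => m; rewrite mem_upper => /andP[]. Qed.

(** A face is recovered from the two data seen in a term, because T = gcd(T) [T]. *)
Lemma face_eq S T : S != fset0 -> T != fset0 -> gcd_set S = gcd_set T ->
  bracket S = bracket T -> S = T.
Proof.
move=> S0 T0 gST bST; apply/fsetP => x; apply/idP/idP => xS.
  have : (x - gcd_set S)%MM \in bracket T by rewrite -bST mem_bracket // subKm ?gcd_set_le.
  by rewrite mem_bracket // -gST subKm ?gcd_set_le.
have : (x - gcd_set T)%MM \in bracket S by rewrite bST mem_bracket // subKm ?gcd_set_le.
by rewrite mem_bracket // gST subKm ?gcd_set_le.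
Qed.

(* The term ['X_[u] *: y] is supported in [D]: the translate by [u] of the    *)
(* fiber of the degree of [y] lies in [D].                                    *)
Definition term_in j D u (y : F j) : Prop :=
  forall w, degA w = bdeg y -> (u + w)%MM \in D.

(** All products x^u x^w share the divisor x^u, so closedness of D makes one of them in D enough. *)
Lemma term_in_closed j b D u (y : F j) w : basic_component b D -> u != 0%MM ->
  degA w = bdeg y -> (u + w)%MM \in D -> term_in D u y.
Proof.
move=> /basic_sphere sD u0 wy uwD w' w'y.
apply: (sphere_closed sD u0 (lem_addr _ w) (lem_addr _ w') uwD).
by rewrite degAD w'y -wy -degAD; exact: (sphere_deg sD uwD).
Qed.

Lemma cf_part j D (z : F j) u y : cf j (proj (B j) (term_in D (j := j)) z) u y =
  if `[< term_in D u y >] then cf j z u y else 0.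
Proof. exact: cf_proj. Qed.

(** A term surviving in the image of the part inside D is cancelled by the image of the part outside
    D. Tracing it back on both sides gives a term outside D with an element of its translated fiber
    in D, against [term_in_closed]. *)
Lemma syz_part j b D (z : F j) : basic_component b D -> (0 < j)%N -> syz z ->
  (forall u y, cf j z u y != 0 -> u != 0%MM) ->
  syz (proj (B j) (term_in D (j := j)) z).
Proof.
move=> bD; case: j z => // j z _ zz z_u; set h := proj _ _ _.
apply: (cf_ext (isB j)) => u y; rewrite cf0 //; apply: contrapT => /eqP hy.
have gy : cf j (phi j (z - h)) u y != 0.
  by rewrite linearB /= zz sub0r cfN // oppr_eq0.
have [v1 [y1 [By1 hy1 le1 ph1]]] := cf_linear_ex (isB j.+1) (isB j) hy.
have [v2 [y2 [By2 hy2 le2 ph2]]] := cf_linear_ex (isB j.+1) (isB j) gy.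
have in1 : term_in D v1 y1.
  by apply: contrapT => nin; case/eqP: hy1; rewrite cf_part asboolF.
have [nin2 zy2] : ~ term_in D v2 y2 /\ cf j.+1 z v2 y2 != 0.
  by move: hy2; rewrite cfB // cf_part; case: asboolP; rewrite ?subrr ?eqxx ?subr0.
have [w wy] := basis_fiber_neq0 (cf_basisB ph1).
apply: nin2; apply: (term_in_closed bD (z_u _ _ zy2) (w := (u - v2 + w)%MM)).
  by rewrite degAD wy (phi_deg By2 ph2).
rewrite addmA subKm // -(subKm le1) -addmA; apply: in1.
by rewrite degAD wy (phi_deg By1 ph1).
Qed.

Record term_face j b D u (y : F j) : Prop := {
  upper_neq0 : upper D u != fset0;
  upper_proper : upper D u `<` D;
  upper_gcd : gcd_set (upper D u) = u;
  upper_fiber : forall v, (v \in bracket (upper D u)) = (degA v == bdeg y);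
  upper_basic : basic_fiber_component L (bracket (upper D u)) }.

(** The gcd of [upper D u] is exactly u because the fiber of the degree of y has gcd 1, by
    [no_common_divisor]. The face is proper because gcd(D) = 1 and u is nonzero. *)
Lemma term_faceP j b D u (y : F j) : basic_component b D -> B j y -> u != 0%MM ->
  term_in D u y -> term_face b D u y.
Proof.
move=> bD By u0 uyD; have sD := basic_sphere bD.
have [w0 w0y] := basis_fiber_neq0 By.
have upT w : degA w = bdeg y -> (u + w)%MM \in upper D u.
  by move=> wy; rewrite mem_upper uyD // lem_addr.
have T0 : upper D u != fset0 by apply/fset0Pn; exists (u + w0)%MM; exact: upT.
have gT : gcd_set (upper D u) = u.
  apply: lepm_anti; last first.
    by apply/(le_gcd_set _ T0) => m; rewrite mem_upper => /andP[].
  apply/mnm_lepP => l; have [v [vy vl]] := no_common_divisor l By.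
  have /mnm_lepP/(_ l) := gcd_set_le (upT _ vy); by rewrite mnmDE vl addn0.
split=> //; last exact: (face_basic bD T0 (upper_sub _ _)).
  rewrite fproperEneq upper_sub andbT; apply: contra_neq u0 => TD.
  by rewrite -gT TD (sphere_gcd sD).
move=> v; rewrite mem_bracket // gT; apply/idP/eqP => [|/upT //].
move/(fsubsetP (upper_sub _ _))/(sphere_deg sD); rewrite -(sphere_deg sD (uyD _ w0y)).
by rewrite !degAD w0y => /addrI.
Qed.

(* [e C] is the basis element of [F j] corresponding to [E_C], and            *)
(* [mu C *: e C] will be the image of [E_C]. [part_cycle] is the form in      *)
(* which the acyclicity of the boundary of a simplex is used: a cycle all of  *)
(* whose faces contain the vertex [v] vanishes.                               *)
Record scarf_part j (e : idx j -> F j) (mu : idx j -> k) : Prop := {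
  part_inj : injective e;
  part_basis : forall C, B j (e C);
  part_coef : forall C, mu C != 0;
  part_deg : forall C, bdeg (e C) = index_degree C;
  part_full : forall (y : F j) D, B j y -> basic_fiber_component L D ->
    (forall v, (v \in D) = (degA v == bdeg y)) -> exists2 C : idx j, val C = D & e C = y;
  part_syz : forall C : idx j.+1,
    syz (bd (extend (fun C => (mu C)%:MP *: e C)) (val C));
  part_cycle : forall b D v (z : F j), basic_component b D -> v \in D -> syz z ->
    (forall u y, cf j z u y != 0 -> [/\ u != 0%MM, (u <= v)%MM & term_in D u y]) ->
    z = 0 }.

(** * The inductive step on the homological degree *)

Section Step.
Variables (j : nat) (e : idx j -> F j) (mu : idx j -> k).
Hypothesis he : scarf_part e mu.
Let f := extend (fun C => (mu C)%:MP *: e C).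

Lemma face_index b D T : basic_component b D -> T != fset0 -> T `<=` D ->
  #|` T| = j.+1 -> exists C : idx j, val C = bracket T.
Proof.
move=> bD T0 TD cT; apply: basic_index_ex; last by rewrite card_bracket.
exact: (face_basic bD T0 TD).
Qed.

Lemma card_fsetD1 T m : m \in T -> #|` T| = j.+2 -> #|` T `\ m| = j.+1.
Proof. by move=> mT; rewrite (cardfsD1 m T) mT add1n => -[]. Qed.

Lemma facet_index b D T m : basic_component b D -> T `<=` D -> #|` T| = j.+2 ->
  m \in T -> exists C : idx j, val C = bracket (T `\ m).
Proof.
move=> bD TD cT mT; apply: (face_index bD); last exact: card_fsetD1.
  by rewrite fsetD1_neq0 ?cT.
exact: fsubset_trans (fsubD1set _ _) TD.
Qed.

Lemma cf_facet b D T m u y : basic_component b D -> T `<=` D -> #|` T| = j.+2 ->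
  m \in T -> forall C : idx j, val C = bracket (T `\ m) ->
  cf j (sg k m T *: ('X_[gcd_set (T `\ m)] *: f (bracket (T `\ m)))) u y =
  (-1) ^+ lex_rank m T * (mu C * ((gcd_set (T `\ m), e C) == (u, y))%:R).
Proof.
move=> bD TD cT mT C eC; rewrite -eC /f extend_val.
rewrite sgE cfC // scalerA [X in X *: _]mulrC -scalerA cfC // cf_term //.
exact: (part_basis he C).
Qed.

Lemma bd_term b D T u y : basic_component b D -> T `<=` D -> #|` T| = j.+2 ->
  cf j (bd f T) u y != 0 ->
  exists2 m, m \in T & exists2 C : idx j, val C = bracket (T `\ m) &
    u = gcd_set (T `\ m) /\ y = e C.
Proof.
move=> bD TD cT h; apply: contrapT => hn; case/eqP: h.
rewrite /bd cf_sum // big_seq big1 // => m mT.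
have [C eC] := facet_index bD TD cT mT; rewrite (cf_facet _ _ bD TD cT mT eC).
case: eqP => [[uE yE]|_]; last by rewrite !mulr0.
by case: hn; exists m => //; exists C.
Qed.

(** Distinct facets give distinct terms, by [part_inj] and [face_eq], so nothing cancels. *)
Lemma bd_facet_neq0 b D T m (C : idx j) : basic_component b D -> T `<=` D ->
  #|` T| = j.+2 -> m \in T -> val C = bracket (T `\ m) ->
  cf j (bd f T) (gcd_set (T `\ m)) (e C) != 0.
Proof.
move=> bD TD cT mT eC; have Tm0 m' : T `\ m' != fset0 by rewrite fsetD1_neq0 ?cT.
pose G m' := cf j (sg k m' T *: ('X_[gcd_set (T `\ m')] *: f (bracket (T `\ m'))))
  (gcd_set (T `\ m)) (e C).
have -> : cf j (bd f T) (gcd_set (T `\ m)) (e C) = \sum_(m' <- T) G m'.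
  by rewrite /bd cf_sum.
have Gm : G m != 0.
  rewrite /G (cf_facet _ _ bD TD cT mT eC) eqxx mulr1 mulf_neq0 ?signr_eq0 //.
  exact: (part_coef he).
have G0 m' : m' \in T -> m' != m -> G m' = 0.
  move=> m'T m'm; have [C' eC'] := facet_index bD TD cT m'T.
  rewrite /G (cf_facet _ _ bD TD cT m'T eC').
  rewrite xpair_eqE; case: eqP => [gE|_]; last by rewrite !mulr0.
  case: eqP => [/(part_inj he) CE|_]; last by rewrite !mulr0.
  have bE := etrans (esym eC') (etrans (congr1 val CE) eC).
  have ET := face_eq (Tm0 m') (Tm0 m) gE bE.
  have : m' \in T `\ m by rewrite !inE m'm.
  by rewrite -ET !inE eqxx.
move: G Gm G0 => G Gm G0; rewrite (bigD1_seq m) ?fset_uniq //= big_seq_cond big1 ?addr0 //.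
by move=> m' /andP[]; exact: G0.
Qed.

Lemma bd_term_in b D T u y : basic_component b D -> T `<=` D -> #|` T| = j.+2 ->
  cf j (bd f T) u y != 0 -> u != 0%MM /\ term_in D u y.
Proof.
move=> bD TD cT /(bd_term bD TD cT)[m mT [C eC [uE yE]]].
have Tm0 : T `\ m != fset0 by rewrite fsetD1_neq0 ?cT.
have sub : T `\ m `<=` D by exact: fsubset_trans (fsubD1set _ _) TD.
have u0 : u != 0%MM.
  rewrite uE; apply/eqP => /(face_gcd_eq0 bD Tm0 sub) TmD.
  have : m \in T `\ m by rewrite TmD (fsubsetP TD).
  by rewrite !inE eqxx.
split=> //; have [w wC] := val_index_ex C.
apply: (term_in_closed bD u0 (w := w)).
  by rewrite yE (part_deg he) (index_degreeE wC).
by move: wC; rewrite eC mem_bracket // -uE => /(fsubsetP sub).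
Qed.

Lemma term_index b D u (y : F j) : basic_component b D -> B j y -> u != 0%MM ->
  term_in D u y ->
  #|` upper D u| = j.+1 /\ exists2 C : idx j, val C = bracket (upper D u) & e C = y.
Proof.
move=> bD By u0 uyD; have tf := term_faceP bD By u0 uyD.
have [C eC Cy] := part_full he By (upper_basic tf) (upper_fiber tf).
by split; [rewrite -card_bracket -eC (basic_indexP C).2|exists C].
Qed.

(** Any term of phi(x) is supported in D and comes from a proper face, which has [j.+1] elements by
    [term_index]. *)
Lemma basis_fiber_card b D (x : F j.+1) : basic_component b D -> B j.+1 x ->
  (forall v, (v \in D) = (degA v == bdeg x)) -> (j.+1 < #|` D|)%N.
Proof.
move=> bD Bx Dx; have [u [y uy]] := cf_neq0_ex (phi_basis_neq0 Bx).
have By := cf_basisB uy.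
have u0 : u != 0%MM by apply: contraNneq uy => ->; rewrite phi_coef0.
have uyD : term_in D u y.
  by move=> w wy; rewrite Dx degAD wy (phi_deg Bx uy).
have [cT _] := term_index bD By u0 uyD; rewrite -cT.
by apply: fproper_ltn_card; exact: (upper_proper (term_faceP bD By u0 uyD)).
Qed.

(* Simplicity forces [phi x] to be supported in [D] as soon as one of its     *)
(* terms is, because its part supported in [D] is again a syzygy.             *)
Lemma simple_term_in b D (x : F j.+1) u0 y0 : basic_component b D -> #|` D| = j.+2 ->
  B j.+1 x -> bdeg x = b -> cf j (phi j x) u0 y0 != 0 -> term_in D u0 y0 ->
  forall u y, cf j (phi j x) u y != 0 -> term_in D u y.
Proof.
move=> bD cD Bx dx nz0 in0; case: (posnP j) => [j0|j_gt0] u y uy.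
  move=> w wy; apply: (basic_card2 bD); first by rewrite cD j0.
  by rewrite degAD wy (phi_deg Bx uy).
have coef0 v z : cf j (phi j x) v z != 0 -> v != 0%MM.
  by move=> h; apply: contraNneq h => ->; rewrite phi_coef0.
pose h := proj (B j) (term_in D (j := j)) (phi j x).
apply: contrapT => nin; case: (simF Bx) => _ _ _; apply; exists h; split.
- apply/eqP => h0; have := cf_part D (phi j x) u0 y0; rewrite -/h h0 cf0 //.
  rewrite asboolT // => /esym/eqP.
  by rewrite (negPf nz0).
- exists (bdeg x); apply: (cf_hom (gF j) (isB j) (@hB j)) => v z; rewrite cf_part.
  by case: asboolP => [_|]; rewrite ?eqxx // => /(phi_deg Bx).
- by apply: syz_part bD j_gt0 (syz_phi x) _ => v z; exact: coef0.
split=> [v z|sub].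
  by rewrite !syz_supportE // cf_part; case: asboolP => //; rewrite eqxx.
apply: nin; have /sub := (syz_supportE (isB j) (phi j x) u y).2 uy.
by rewrite syz_supportE // cf_part; case: asboolP => //; rewrite eqxx.
Qed.

Lemma fsetD1_of_card D T : T `<=` D -> #|` D| = j.+2 -> #|` T| = j.+1 ->
  exists2 m, m \in D & T = D `\ m.
Proof.
move=> TD cD cT; have cDT : #|` D `\` T| == 1%N.
  by rewrite cardfsD (fsetIidPr TD) cD cT subSnn.
have /cardfs1P[m Dm] := cDT; exists m.
  by have : m \in D `\` T; [rewrite Dm inE|rewrite inE => /andP[]].
by rewrite -Dm fsetDK.
Qed.

(** Exactness gives y with phi(y) equal to the boundary of D. The required x is a basis element
    occurring in y whose image contains the term of a chosen facet. *)
Lemma step_exists (C : idx j.+1) : exists x : F j.+1, exists c : k,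
  [/\ B j.+1 x, c != 0, bdeg x = index_degree C & phi j x = c%:MP *: bd f (val C)].
Proof.
have [[b bD] cD] := basic_indexP C; set D := val C in bD cD *.
have sD := basic_sphere bD; have DD := fsubset_refl D.
have [y hy] := (res_exact res _).1 (part_syz he C).
have [m0 m0D] := val_index_ex C; have [C0 eC0] := facet_index bD DD cD m0D.
set g0 := gcd_set (D `\ m0).
have nz0 : cf j (bd f D) g0 (e C0) != 0 := bd_facet_neq0 bD DD cD m0D eC0.
have [g0_neq0 in0] := bd_term_in bD DD cD nz0.
have [u [x [Bx yx le_u nzx]]] : exists u x, [/\ B j.+1 x, cf j.+1 y u x != 0,
    (u <= g0)%MM & cf j (phi j x) (g0 - u)%MM (e C0) != 0].
  by apply: (cf_linear_ex (isB j.+1) (isB j)); rewrite hy.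
have [w wC0] := basis_fiber_neq0 (part_basis he C0).
have in_x : (u + (g0 - u + w))%MM \in D by rewrite addmA subKm // in0.
have deg_x : degA (g0 - u + w)%MM = bdeg x by rewrite degAD wC0 (phi_deg Bx nzx).
(* Otherwise x would live over the bracket of a proper face of D, which has fewer than [j.+2]
   elements, against [basis_fiber_card]. *)
have u0 : u = 0%MM.
  apply/eqP; apply: contraT => u_neq0.
  have tf := term_faceP bD Bx u_neq0 (term_in_closed bD u_neq0 deg_x in_x).
  have [b' bT] := upper_basic tf.
  have := basis_fiber_card bT Bx (upper_fiber tf).
  by rewrite card_bracket -cD leqNgt fproper_ltn_card ?(upper_proper tf).
rewrite u0 subm0 add0m in nzx in_x deg_x.
have bx : bdeg x = b by rewrite -deg_x; exact: (sphere_deg sD in_x).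
have x_in := simple_term_in bD cD Bx bx nzx in0.
(* This ratio cancels the facet opposite to [m0] in [phi j x - c%:MP *: bd f D]. All other facets
   contain [m0], so [part_cycle] makes the difference vanish. *)
pose c := cf j (phi j x) g0 (e C0) / cf j (bd f D) g0 (e C0).
have c0 : c != 0 by rewrite mulf_neq0 ?invr_eq0.
exists x, c; split=> //; first by rewrite bx -(index_degreeE m0D) (sphere_deg sD m0D).
apply/eqP; rewrite -subr_eq0; apply/eqP.
apply: (part_cycle he bD m0D); first by apply: syzB (syz_phi x) _; apply/syzZ/(part_syz he C).
move=> v z vz.
have [v0 v_in [m mD [gv [C' eC' zC']]]] : [/\ v != 0%MM, term_in D v z &
    exists2 m, m \in D & v = gcd_set (D `\ m) /\
      exists2 C' : idx j, val C' = bracket (D `\ m) & z = e C'].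
  have [xz|/negPn/eqP xz] := boolP (cf j (phi j x) v z != 0).
    have v0 : v != 0%MM by apply: contraNneq xz => ->; rewrite phi_coef0.
    have vD := x_in _ _ xz; split=> //.
    have Bz := cf_basisB xz; have [cT [C' eC' eC'z]] := term_index bD Bz v0 vD.
    have gv := upper_gcd (term_faceP bD Bz v0 vD).
    have [m mD Tm] := fsetD1_of_card (upper_sub D v) cD cT; exists m => //.
    by rewrite -Tm; split=> //; exists C'.
  have hz : cf j (bd f D) v z != 0.
    apply: contraNneq vz => hz; rewrite cfB // cfC // hz xz mulr0 subrr; by [].
  have [v0 vD] := bd_term_in bD DD cD hz; split=> //.
  have [m mD [C' eC' [gv zC']]] := bd_term bD DD cD hz; exists m => //.
  by split=> //; exists C'.
split=> //; have [mm|mm] := eqVneq m m0; last first.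
  by rewrite gv; apply: gcd_set_le; rewrite !inE eq_sym mm.
move: vz; rewrite zC' gv mm -/g0.
have -> : C' = C0 by apply: val_inj; rewrite eC' mm -eC0.
by rewrite cfB // cfC // /c divfK // subrr eqxx.
Qed.

(** * Passing the induction hypothesis to the next degree *)

Section Next.
Variables (e' : idx j.+1 -> F j.+1) (mu' : idx j.+1 -> k).
Hypothesis e'_basis : forall C, B j.+1 (e' C).
Hypothesis mu'_neq0 : forall C, mu' C != 0.
Hypothesis e'_deg : forall C, bdeg (e' C) = index_degree C.
Hypothesis phi_e' : forall C, phi j ((mu' C)%:MP *: e' C) = bd f (val C).
Let f' := extend (fun C => (mu' C)%:MP *: e' C).

Lemma phi_extend T (C : idx j.+1) : val C = bracket T ->
  'X_[gcd_set T] *: phi j (f' (bracket T)) = bd f T.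
Proof.
move=> eC; rewrite -eC /f' extend_val phi_e' eC; apply: bd_bracket.
by rewrite -card_bracket -eC (basic_indexP C).2.
Qed.

Lemma cf_phi_e' T (C : idx j.+1) u y : val C = bracket T ->
  cf j (bd f T) u y = mu' C * cf j ('X_[gcd_set T] *: phi j (e' C)) u y.
Proof.
move=> eC; rewrite -(phi_extend eC) -eC /f' extend_val linearZ /=.
by rewrite scalerA [X in X *: _]mulrC -scalerA cfC.
Qed.

Lemma card_of_index T (C : idx j.+1) : val C = bracket T -> #|` T| = j.+2.
Proof. by move=> eC; rewrite -card_bracket -eC (basic_indexP C).2. Qed.

Lemma bracket_val (C : idx j.+1) : gcd_set (val C) = 0%MM /\ val C = bracket (val C).
Proof.
have [[b /basic_sphere sC] _] := basic_indexP C.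
by rewrite bracket_gcd0 ?(sphere_neq0 sC) ?(sphere_gcd sC).
Qed.

(** The terms of phi(e' C) determine the facets of C. Each facet of C is thus a facet of C', and the
    facets of C cover C. *)
Lemma next_inj : injective e'.
Proof.
move=> C C' eCC'; apply: val_inj.
have [[b bC] cC] := basic_indexP C; have [[b' bC'] cC'] := basic_indexP C'.
have [gC brC] := bracket_val C; have [gC' brC'] := bracket_val C'.
have facet_sub m : m \in val C -> val C `\ m `<=` val C'.
  move=> mC; have [C0 eC0] := facet_index bC (fsubset_refl _) cC mC.
  have := bd_facet_neq0 bC (fsubset_refl _) cC mC eC0.
  rewrite (cf_phi_e' _ _ brC) mulf_eq0 negb_or gC mpolyX0 scale1r => /andP[_ nz].
  have nz' : cf j (bd f (val C')) (gcd_set (val C `\ m)) (e C0) != 0.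
    by rewrite (cf_phi_e' _ _ brC') gC' mpolyX0 scale1r -eCC' mulf_neq0.
  have [m' m'C' [C1 eC1 [gE eE]]] := bd_term bC' (fsubset_refl _) cC' nz'.
  have bE := etrans (esym eC0) (etrans (congr1 val (part_inj he eE)) eC1).
  rewrite (face_eq _ _ gE bE) ?fsubD1set ?fsetD1_neq0 ?cC ?cC' //.
apply/eqP; rewrite eqEfcard cC cC' leqnn andbT; apply/fsubsetP => x xC.
have /fset0Pn[m] : val C `\ x != fset0 by rewrite fsetD1_neq0 ?cC.
rewrite !inE => /andP[mx mC]; apply: (fsubsetP (facet_sub m mC)).
by rewrite !inE eq_sym mx.
Qed.

Lemma upper_ext D u v T : T = upper D u -> v \in D -> ~~ (u <= v)%MM ->
  (v |` T) `\ v = T.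
Proof.
move=> -> vD uv; apply/fsetP => x; rewrite !inE.
by have [->|] := eqVneq x v; rewrite ?(negPf uv) ?andbF.
Qed.

(** Fix v in D and cone off the terms of phi(x) whose monomial does not divide v, obtaining w. Then
    phi(x) - phi(w) involves only faces containing v, so it vanishes by [part_cycle]. *)
Lemma next_full (x : F j.+1) D : B j.+1 x -> basic_fiber_component L D ->
  (forall v, (v \in D) = (degA v == bdeg x)) ->
  exists2 C : idx j.+1, val C = D & e' C = x.
Proof.
move=> Bx [b bD] Dx; have sD := basic_sphere bD.
have /fset0Pn[v vD] := sphere_neq0 sD.
set z := phi j x; pose s := term_seq (B j) z.
have s_cf t : t \in s -> cf j z t.1 t.2 != 0.
  by case: t => u y; rewrite mem_term_seq.
have z_in u y : cf j z u y != 0 -> u != 0%MM /\ term_in D u y.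
  move=> uy; split; first by apply: contraNneq uy => ->; rewrite phi_coef0.
  by move=> w wy; rewrite Dx degAD wy (phi_deg Bx uy).
have s_idx t : t \in s -> #|` upper D t.1| = j.+1 /\
    exists2 C : idx j, val C = bracket (upper D t.1) & e C = t.2.
  move=> /s_cf ts; have [t0 tD] := z_in _ _ ts.
  exact: (term_index bD (cf_basisB ts) t0 tD).
pose S t := v |` upper D (t : mon * F j).1.
have SD t : S t `<=` D.
  by apply/fsubsetP => w; rewrite !inE => /orP[/eqP->|/andP[]].
have cS t : t \in s -> ~~ (t.1 <= v)%MM -> #|` S t| = j.+2.
  move=> ts tv; rewrite cardfsU1 mem_upper (negPf tv) andbF.
  by have [-> _] := s_idx t ts.
have S0 t : S t != fset0 by apply/fset0Pn; exists v; rewrite !inE eqxx.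
have S_idx t : t \in s -> ~~ (t.1 <= v)%MM -> exists C : idx j.+1, val C = bracket (S t).
  move=> ts tv; apply: basic_index_ex; last by rewrite card_bracket cS.
  exact: (face_basic bD (S0 t) (SD t)).
have S_nz t : t \in s -> ~~ (t.1 <= v)%MM -> cf j (bd f (S t)) t.1 t.2 != 0.
  move=> ts tv; have [_ [C eC Ct]] := s_idx t ts; have tf := s_cf t ts.
  have [t0 tD] := z_in _ _ tf.
  have St := upper_ext (erefl (upper D t.1)) vD tv.
  have vS : v \in S t by rewrite !inE eqxx.
  have := bd_facet_neq0 bD (SD t) (cS t ts tv) vS (C := C).
  by rewrite St (upper_gcd (term_faceP bD (cf_basisB tf) t0 tD)) Ct; apply.
(* The facets of [S t] other than the one opposite to v contain v, so their gcds divide v. *)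
have S_eq t u y : t \in s -> ~~ (t.1 <= v)%MM -> ~~ (u <= v)%MM ->
    cf j (bd f (S t)) u y != 0 -> t = (u, y).
  move=> ts tv uv nz; have [m mS [C eC [gu yC]]] := bd_term bD (SD t) (cS t ts tv) nz.
  have tf := s_cf t ts; have [t0 tD] := z_in _ _ tf.
  have mv : m = v.
    apply/eqP; apply: contraNT uv => mv; rewrite gu; apply: gcd_set_le.
    by rewrite !inE eqxx eq_sym mv.
  have St := upper_ext (erefl (upper D t.1)) vD tv.
  move: gu eC; rewrite mv St (upper_gcd (term_faceP bD (cf_basisB tf) t0 tD)) => gu eC.
  have [_ [C1 eC1 C1t]] := s_idx t ts.
  have CC1 : C1 = C by apply: val_inj; rewrite eC1 eC.
  by rewrite gu yC -CC1 C1t -surjective_pairing.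
(* Chosen so that [phi j w] has the coefficient of z at the facet of [S t] opposite to v. *)
pose kap t := cf j z t.1 t.2 / cf j (bd f (S t)) t.1 t.2.
(* The cone with apex [v] over the part of [z] not containing [v].            *)
pose w := \sum_(t <- s | ~~ (t.1 <= v)%MM)
  (kap t)%:MP *: ('X_[gcd_set (S t)] *: f' (bracket (S t))).
have phi_w : phi j w = \sum_(t <- s | ~~ (t.1 <= v)%MM) (kap t)%:MP *: bd f (S t).
  rewrite linear_sum big_seq_cond [RHS]big_seq_cond; apply: eq_bigr => t /andP[ts tv].
  have [C eC] := S_idx t ts tv; rewrite linearZ; congr (_ *: _).
  by rewrite linearZ -(phi_extend eC).
have cf_w u y : cf j (phi j w) u y = \sum_(t <- s | ~~ (t.1 <= v)%MM)
    kap t * cf j (bd f (S t)) u y.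
  by rewrite phi_w cf_sum //; apply: eq_bigr => t _; rewrite cfC.
have z_w : z - phi j w = 0.
  apply: (part_cycle he bD vD); first by apply: syzB; exact: syz_phi.
  move=> u y uy; have u_v : (u <= v)%MM.
    apply: contraNT uy => uv; rewrite cfB // cf_w subr_eq0 eq_sym; apply/eqP.
    have [uys|uys] := boolP ((u, y) \in s); last first.
      rewrite big_seq_cond big1 => [|t /andP[ts tv]].
        by apply/eqP; rewrite eq_sym; apply: contraNT uys => h; rewrite mem_term_seq.
      have [->|nz] := eqVneq (cf j (bd f (S t)) u y) 0; first by rewrite mulr0.
      by rewrite -(S_eq t u y ts tv uv nz) ts in uys.
    rewrite big_mkcond (bigD1_seq (u, y)) ?term_seq_uniq // uv /kap divfK; last first.
      exact: (S_nz (u, y) uys uv).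
    rewrite big_seq_cond big1; first exact: addr0.
    move=> t /andP[ts tuy]; case: ifP => // tv.
    have [->|nz] := eqVneq (cf j (bd f (S t)) u y) 0; first by rewrite mulr0.
    by rewrite -(S_eq t u y ts tv uv nz) eqxx in tuy.
  suff [u0 uD] : u != 0%MM /\ term_in D u y by [].
  have [/z_in //|/negPn/eqP z0] := boolP (cf j z u y != 0).
  have [t ts /andP[tv nz]] : exists2 t, t \in s & ~~ (t.1 <= v)%MM &&
      (cf j (bd f (S t)) u y != 0).
    apply: contrapT => hn; case/eqP: uy; rewrite cfB // z0 cf_w big_seq_cond big1 ?subr0 //.
    move=> t /andP[ts tv]; apply: contrapT => /eqP nz; apply: hn; exists t => //.
    by rewrite tv; apply: contraNneq nz => ->; rewrite mulr0.
  exact: (bd_term_in bD (SD t) (cS t ts tv) nz).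
(* By minimality x occurs in w with constant coefficient 1. So some cone [S t] has gcd 1, and is
   therefore all of D. *)
have : syz (x - w) by rewrite /= linearB.
move/(syz_coef0 x)/eqP; rewrite cfB // cf_of_basis // eqxx subr_eq0 => /eqP w1.
have [t ts /andP[tv nz]] : exists2 t, t \in s & ~~ (t.1 <= v)%MM &&
    (cf j.+1 ('X_[gcd_set (S t)] *: f' (bracket (S t))) 0%MM x != 0).
  apply: contrapT => hn; have/eqP := oner_neq0 k; apply; rewrite [1]w1 /w cf_sum //.
  rewrite big_seq_cond big1 // => t /andP[ts tv]; rewrite cfC //.
  apply: contrapT => /eqP nz; apply: hn; exists t => //.
  by rewrite tv; apply: contraNneq nz => ->; rewrite mulr0.
have [C eC] := S_idx t ts tv.
move: nz; rewrite cfX //; case: ifP => [/lepm0_eq0 gS|]; last by rewrite eqxx.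
have eSD := face_gcd_eq0 bD (S0 t) (SD t) gS.
rewrite gS subm0 -eC /f' extend_val cfC // cf_of_basis // => h; exists C.
  by rewrite eC bracket_gcd0.
have [//|ne] := eqVneq (e' C) x.
by move: h; rewrite xpair_eqE (negPf ne) andbF mulr0 eqxx.
Qed.

Lemma next_syz (C : idx j.+2) : syz (bd f' (val C)).
Proof.
have [[b bC] cC] := basic_indexP C.
rewrite /=; transitivity (\sum_(m <- val C) sg k m (val C) *: bd f (val C `\ m));
  last exact: bd_bd.
rewrite {1}/bd linear_sum; apply: eq_big_seq => m mC.
have [C' eC'] := basic_face mC; rewrite linearZ; congr (_ *: _).
by rewrite linearZ; exact: (phi_extend eC').
Qed.

(** All faces T occurring in z contain v, and T \ v is a facet of no other such face. So the
    coefficient of T in z survives in phi(z) and has to be 0. *)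
Lemma next_cycle b D v (z : F j.+1) : basic_component b D -> v \in D -> syz z ->
  (forall u y, cf j.+1 z u y != 0 -> [/\ u != 0%MM, (u <= v)%MM & term_in D u y]) ->
  z = 0.
Proof.
move=> bD vD zz z_in; apply/eqP; apply: contraT => /cf_neq0_ex[u [y uy]].
have idx_of u1 y1 : cf j.+1 z u1 y1 != 0 -> [/\ gcd_set (upper D u1) = u1,
    v \in upper D u1 & exists2 C : idx j.+1, val C = bracket (upper D u1) & e' C = y1].
  move=> h; have [u0 uv uD] := z_in _ _ h.
  have tf := term_faceP bD (cf_basisB h) u0 uD.
  split; [exact: upper_gcd tf|by rewrite mem_upper vD|].
  exact: (next_full (cf_basisB h) (upper_basic tf) (upper_fiber tf)).
have [gT vT [C eC Cy]] := idx_of _ _ uy; set T := upper D u in gT vT eC.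
have TD : T `<=` D := upper_sub D u; have cT := card_of_index eC.
have [C0 eC0] := facet_index bD TD cT vT; set g0 := gcd_set (T `\ v).
have : cf j (phi j z) g0 (e C0) = 0 by rewrite zz cf0.
have nz := bd_facet_neq0 bD TD cT vT eC0.
have uys : (u, y) \in term_seq (B j.+1) z by rewrite mem_term_seq.
rewrite (cf_linear (isB j.+1) (isB j)) (bigD1_seq (u, y)) ?term_seq_uniq //=.
rewrite big_seq_cond big1 ?addr0 => [|[u1 y1]].
  move/eqP; rewrite mulf_eq0 (negPf uy) /= => /eqP h.
  by move: nz; rewrite (cf_phi_e' _ _ eC) gT Cy h mulr0 eqxx.
rewrite mem_term_seq // => /andP[h ne]; rewrite /=.
have [gT1 vT1 [C1 eC1 C1y]] := idx_of _ _ h; set T1 := upper D u1 in gT1 vT1 eC1.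
have T1D : T1 `<=` D := upper_sub D u1; have cT1 := card_of_index eC1.
have [->|nz1] := eqVneq (cf j ('X_[u1] *: phi j y1) g0 (e C0)) 0; first by rewrite mulr0.
have nz2 : cf j (bd f T1) g0 (e C0) != 0.
  by rewrite (cf_phi_e' _ _ eC1) gT1 C1y mulf_neq0.
have [m mT1 [C2 eC2 [gE eE]]] := bd_term bD T1D cT1 nz2.
have bE := etrans (esym eC0) (etrans (congr1 val (part_inj he eE)) eC2).
have TE : T `\ v = T1 `\ m.
  by apply: (face_eq _ _ gE bE); rewrite fsetD1_neq0 ?cT ?cT1.
have mv : m = v.
  apply/eqP; apply: contraT => mv.
  have : v \in T1 `\ m by rewrite in_fsetD1 eq_sym mv.
  by rewrite -TE in_fsetD1 eqxx.
have T1T : T1 = T by rewrite -(fsetD1K vT) TE mv fsetD1K.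
case/eqP: ne; congr (_, _); first by rewrite -gT1 T1T.
by rewrite -C1y -Cy; congr e'; apply: val_inj; rewrite eC1 eC T1T.
Qed.

Lemma next_good : scarf_part e' mu'.
Proof.
split=> //; [exact: next_inj|exact: next_full|exact: next_syz|exact: next_cycle].
Qed.

End Next.

Lemma part_next : exists (e' : idx j.+1 -> F j.+1) (mu' : idx j.+1 -> k),
  scarf_part e' mu' /\ forall C, phi j ((mu' C)%:MP *: e' C) = bd f (val C).
Proof.
have [x_ /choice[c_ xc]] := choice step_exists.
have phi_x C : phi j (((c_ C)^-1)%:MP *: x_ C) = bd f (val C).
  have [_ c0 _] := xc C; rewrite linearZ => /= ->.
  by rewrite scalerA -mpolyCM mulVf // mpolyC1 scale1r.
exists x_, (fun C => (c_ C)^-1); split=> //; apply: next_good => [C|C|C|//];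
  by have [Bx c0 dx _] := xc C; rewrite ?invr_eq0.
Qed.

End Step.

(** * Homological degree 0 and the recursion *)

Lemma fiber0_index : exists C : idx 0, val C = [fset (0%MM : mon)].
Proof.
apply: basic_index_ex; last by rewrite cardfs1.
exists 0; apply: full_basic => [|v||m].
- by apply/fset0Pn; exists 0%MM; rewrite inE.
- by rewrite inE; apply/eqP/eqP => [->|/degA_eq0 //]; rewrite degA0.
- by apply: lepm0_eq0; apply: gcd_set_le; rewrite inE.
by rewrite inE => /eqP->; rewrite fsetDv eqxx.
Qed.

Lemma basic_index0 (C : idx 0) : val C = [fset (0%MM : mon)].
Proof.
have [[b /basic_sphere sC] cC] := basic_indexP C.
have /cardfs1P[m Cm] : #|` val C| == 1%N by rewrite cC.
rewrite Cm; congr [fset _]; apply: lepm0_eq0; rewrite -(sphere_gcd sC).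
by apply/(le_gcd_set _ (sphere_neq0 sC)) => x; rewrite Cm inE => /eqP->; exact: lepm_refl.
Qed.

Lemma sum_sign_pair T : #|` T| = 2 -> \sum_(m <- T) (-1) ^+ lex_rank m T = 0 :> k.
Proof.
move=> cT; have /fset0Pn[m mT] : T != fset0 by rewrite -cardfs_gt0 cT.
have /cardfs1P[m' Tm'] : #|` T `\ m| == 1%N.
  by have := cardfsD1 m T; rewrite cT mT add1n => -[<-].
have m'Tm : m' \in T `\ m by rewrite Tm' inE.
have /fsetD1P[m'm m'T] := m'Tm.
have Tm : T `\ m' = [fset m].
  by rewrite -(fsetD1K mT) Tm' fsetUC fsetU1K // inE.
have r1 x : lex_rank x [fset x] = 0%N.
  rewrite /lex_rank; have /permP-> : perm_eq [fset x] [:: x].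
    by apply: uniq_perm; rewrite ?fset_uniq // => y; rewrite !inE.
  by rewrite /= /lex_lt eqxx andbF.
have permT : perm_eq T [:: m; m'].
  apply: uniq_perm; rewrite ?fset_uniq //= ?inE 1?eq_sym ?m'm // => x.
  by rewrite -{1}(fsetD1K mT) Tm' !inE.
rewrite (perm_big _ permT) big_cons big_seq1.
rewrite (lex_rankD1 m m'T) (lex_rankD1 m' mT) Tm Tm' !r1 !addn0.
rewrite (lex_ltNge m'm); case: (lex_lt m' m) => /=.
  by rewrite expr1 expr0 addNr.
by rewrite expr1 expr0 addrN.
Qed.

(** Here every [e C] is the generator of F_0. The boundary of a pair is a cycle because its two
    signs cancel in the coefficient sum; for [part_cycle], z is a single monomial multiple of the
    generator, with coefficient sum 0. *)
Lemma part_zero : exists (e : idx 0 -> F 0) (mu : idx 0 -> k), scarf_part e mu.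
Proof.
have [e0 [Be0 uniq0 de0 ge0]] := F0_generator.
have cf_e0 z u y : cf 0 z u y != 0 -> y = e0 by move/cf_basisB/uniq0.
exists (fun=> e0), (fun=> 1); split=> //= [C C' _|C|C|y D /uniq0-> bD|C|b D v z bD vD zz z_in].
- by apply: val_inj; rewrite !basic_index0.
- exact: oner_neq0.
- by rewrite de0 -(@index_degreeE _ _ _ C 0%MM) ?degA0 // basic_index0 inE.
- rewrite de0 => Dv; have [C eC] := fiber0_index; exists C => //.
  apply/fsetP => v; rewrite eC inE Dv; apply/eqP/eqP => [->|/degA_eq0 //].
  by rewrite degA0.
- have [[b bC] cC] := basic_indexP C.
  set h := bd _ _; pose p : R := \sum_(m <- val C) sg k m (val C) * 'X_[gcd_set (val C `\ m)].
  have hp : h = p *: e0.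
    rewrite /h /bd scaler_suml; apply: eq_big_seq => m mC.
    have [C' eC'] := basic_face mC.
    by rewrite -eC' extend_val mpolyC1 scale1r scalerA.
  have [_ /(_ b)] := syz0_sum_coeff h Be0 uniq0 ge0; apply.
    rewrite hp /p scaler_suml big_seq; apply: (hom_sum (gF 0)) => m mC.
    have [C' eC'] := basic_face mC; rewrite -scalerA sgE; apply: (homC (gF 0)).
    have -> : b = degA (gcd_set (val C `\ m)) + bdeg e0.
      have : 0%MM \in val C' by rewrite basic_index0 inE.
      rewrite eC' mem_bracket; last by rewrite fsetD1_neq0 ?cC.
      by rewrite addm0 de0 addr0 => /fsetD1P[_ /(sphere_deg (basic_sphere bC))->].
    by apply: (homX (gF 0)); exact: bdegB.
  rewrite hp bcoordZ // coord_of_basis // eqxx mulr1 /sum_coeff /p rmorph_sum /=.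
  rewrite -[RHS](sum_sign_pair cC); apply: eq_bigr => m _.
  by rewrite mevalM [X in _ * X]sum_coeffX mulr1 sgE mevalC.
(* The fiber of degree 0 is {1}, so the face of the term is the single vertex v. *)
have z_v u y : cf 0 z u y != 0 -> u = v.
  move=> uy; have [u0 uv uD] := z_in _ _ uy.
  have tf := term_faceP bD (cf_basisB uy) u0 uD.
  have : (v - u)%MM \in bracket (upper D u).
    by rewrite mem_bracket ?(upper_neq0 tf) // (upper_gcd tf) subKm // mem_upper vD.
  rewrite (upper_fiber tf) (cf_e0 _ _ _ uy) de0 => /eqP/degA_eq0 vu.
  by rewrite -(subKm uv) vu addm0.
have zE : bcoord (B 0) z e0 = (cf 0 z v e0)%:MP * 'X_[v].
  apply/mpolyP => u; rewrite mcoeffCM mcoeffX; case: (eqVneq v u) => [->|vu].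
    by rewrite mulr1.
  by rewrite mulr0; apply/eqP; apply: contraNT vu => /z_v->.
have [/(_ zz) + _] := syz0_sum_coeff z Be0 uniq0 ge0.
rewrite zE /sum_coeff mevalM mevalC [X in _ * X]sum_coeffX mulr1 => zv.
apply: (cf_ext (isB 0)) => u y; rewrite cf0 //; apply: contrapT => /eqP uy.
by move: (uy); rewrite (z_v _ _ uy) (cf_e0 _ _ _ uy) zv eqxx.
Qed.

(** The data of each degree depend on those chosen before, so they are packed with their properties
    and built by dependent recursion. *)
Lemma part_chain : exists (e : forall j, idx j -> F j) (mu : forall j, idx j -> k),
  (forall j, scarf_part (@e j) (@mu j)) /\
  forall j (C : idx j.+1), phi j ((mu _ C)%:MP *: e _ C) =
    bd (extend (fun C' => (mu j C')%:MP *: e j C')) (val C).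
Proof.
pose P j := {p : (idx j -> F j) * (idx j -> k) | scarf_part p.1 p.2}.
have [p0] : exists p : P 0, True.
  by have [e [mu he]] := part_zero; exists (exist _ (e, mu) he).
pose next j (p : P j) (q : P j.+1) := forall C : idx j.+1,
  phi j (((sval q).2 C)%:MP *: (sval q).1 C) =
    bd (extend (fun C' => ((sval p).2 C')%:MP *: (sval p).1 C')) (val C).
have next_ex j (p : P j) : {q : P j.+1 | next j p q}.
  apply: cid; case: p => -[e mu] he; have [e' [mu' [he' ph]]] := part_next he.
  by exists (exist _ (e', mu') he').
pose chain := nat_rect P p0 (fun j p => sval (next_ex j p)).
exists (fun j => (sval (chain j)).1), (fun j => (sval (chain j)).2).
split=> [j|j C]; first exact: (svalP (chain j)).
exact: (svalP (next_ex j (chain j)) C).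
Qed.
End Resolution.

(** * The embedding *)

Section Embedding.
Variables (n : nat) (k : fieldType) (L : zmodClosed 'rV[int]_n).
Local Notation R := {mpoly k[n]}.
Local Notation idx := (basic_index L).
Variables (j : nat) (M : lmodType R) (hom : deg_group L -> M -> Prop).
Variables (B : M -> Prop) (e : idx j -> M) (mu : idx j -> k).
Hypotheses (gM : is_grading hom) (basisB : is_basis B).
Hypothesis homB : forall y, B y -> homogeneous hom y.
Hypotheses (e_inj : injective e) (eB : forall C, B (e C)).
Hypothesis mu_neq0 : forall C, mu C != 0.
Hypothesis e_deg : forall C, bdeg hom (e C) = index_degree C.

Let G := scarf_module L k j.
Let iota : {linear G -> M} := scarf_lift (fun C => (mu C)%:MP *: e C).

Lemma embed_sum (x : G) : iota x = \sum_(C <- dom x) coeff C x *: ((mu C)%:MP *: e C).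
Proof.
rewrite {1}[x]scarf_sum linear_sum; apply: eq_bigr => C _.
by rewrite linearZ; congr (_ *: _); exact: scarf_liftU.
Qed.

Lemma embed_coord (x : G) C : bcoord B (iota x) (e C) = coeff C x * (mu C)%:MP.
Proof.
rewrite embed_sum bcoord_sum //.
have val_at C' : bcoord B (coeff C' x *: ((mu C')%:MP *: e C')) (e C) =
    if C' == C then coeff C x * (mu C)%:MP else 0.
  rewrite !bcoordZ // coord_of_basis // (inj_eq e_inj).
  by case: eqP => [->|_]; rewrite ?mulr1 ?mulr0.
have [Cx|Cx] := boolP (C \in dom x).
  rewrite (bigD1_seq C) ?uniq_dom //= val_at eqxx big1 ?addr0 // => C' /negPf C'C.
  by rewrite val_at C'C.
rewrite (coeff_outdom Cx) mul0r big_seq big1 // => C' C'x; rewrite val_at.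
by case: eqP => // C'C; rewrite -C'C C'x in Cx.
Qed.

Lemma embed_inj : injective iota.
Proof.
apply: raddf_inj => x x0; apply/eqP/freeg_eqP => C; rewrite coeff0.
have /eqP := embed_coord x C; rewrite x0 bcoord0 // eq_sym mulf_eq0 => /orP[/eqP //|].
by rewrite mpolyC_eq0 (negPf (mu_neq0 C)).
Qed.

Lemma embed_hom b (x : G) : scarf_hom b x -> hom b (iota x).
Proof.
move=> /scarf_homE hx; rewrite embed_sum big_seq; apply: (hom_sum gM) => C Cx.
rewrite -[b](subrK (index_degree C)); apply: (gradingZ gM).
  by move=> u /hx <-; rewrite addrK.
by apply: (homC gM); rewrite -e_deg; exact: (bdegP homB (eB C)).
Qed.

Let inv_e C : G := ((mu C)^-1)%:MP *: (<< C >> : G).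

Lemma embed_inv_e C : iota (inv_e C) = e C.
Proof.
rewrite /inv_e linearZ /= scarf_liftU scalerA -mpolyCM mulVf //.
by rewrite mpolyC1 scale1r.
Qed.

(** B' consists of the elements [e C]; by injectivity their preimages are the E_C divided by
    [mu C]. *)
Lemma embed_basis : exists B' : M -> Prop, (forall y, B' y -> B y) /\
  (is_basis (fun x : G => B' (iota x)) /\
   forall x : G, B' (iota x) -> homogeneous (@scarf_hom n L k j) x).
Proof.
exists (fun y => exists C, y = e C); split=> [y [C ->] //|].
split; last first.
  move=> x [C]; rewrite -embed_inv_e => /embed_inj ->; exists (index_degree C).
  exact/(homC (scarf_is_grading L k j))/scarf_homU.
split=> [x|s c [us sB s0] y ys].
  exists [seq inv_e C | C <- dom x], (fun y => bcoord B (iota x) (iota y)); split.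
  - rewrite map_inj_uniq ?uniq_dom // => C C' /(congr1 iota).
    by rewrite !embed_inv_e; exact: e_inj.
  - by move=> y /mapP[C _ ->]; exists C; exact: embed_inv_e.
  rewrite big_map {1}[x]scarf_sum; apply: eq_bigr => C _.
  by rewrite embed_inv_e embed_coord scalerA -mulrA -mpolyCM mulfV // mpolyC1 mulr1.
move/(congr1 (fun z => bcoord B (iota z) (iota y))): s0.
rewrite linear0 bcoord0 // linear_sum bcoord_sum // => /esym.
have val_at z : z \in s -> bcoord B (iota (c z *: z)) (iota y) =
    if z == y then c y else 0.
  move=> zs; rewrite linearZ bcoordZ //.
  have Bz : B (iota z) by have [C ->] := sB z zs.
  rewrite coord_of_basis // (inj_eq embed_inj).
  by case: eqP => [->|_]; rewrite ?mulr1 ?mulr0.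
rewrite (bigD1_seq y) //= val_at // eqxx big_seq_cond big1 ?addr0 //.
by move=> z /andP[zs /negPf zy]; rewrite val_at // zy.
Qed.

End Embedding.

Theorem theorem5p2 (k : fieldType) (n : nat) (L : zmodClosed 'rV[int]_n)
  (L_pos : forall v : 'rV[int]_n,
     v \in L -> (forall i, 0 <= v 0 i) -> v = 0) :
  indispensable_complex (@scarf_hom n L k) (@scarf_theta n L k).
Proof.
split; first exact: scarf_graded_complex.
move=> F hom phi phi0 B res homB minF simF.
have [e [mu [he phi_e]]] := part_chain L_pos res homB minF simF.
have gF j : is_grading (@hom j) := res_grading res j.
pose iota j : {linear scarf_module L k j -> F j} :=
  scarf_lift (fun C => (mu j C)%:MP *: e j C).
have iota_theta j x : iota j (scarf_theta L k j x) = phi j (iota j.+1 x).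
  rewrite [x]scarf_sum !linear_sum; apply: eq_bigr => C _; rewrite !linearZ.
  congr (_ *: _); rewrite /= scarf_liftU phi_e; exact: scarf_lift_theta.
exists iota; split=> // [j|j b x|j x|j].
- exact: (embed_inj (homB j).1 (part_inj (he j)) (part_basis (he j)) (part_coef (he j))).
- have h := embed_hom _ (gF j) (homB j).2 (part_basis (he j)) (part_deg (he j)); exact: h.
- by exists (scarf_theta L k j x); rewrite iota_theta.
exact: (embed_basis (homB j).1 (part_inj (he j)) (part_basis (he j)) (part_coef (he j))).
Qed.
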